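(* Let $(X,\tau)$ be a locally compact Hausdorff space and $k$ be a $C_0(X)$-kernel. Then the following two statements are equivalent: (i) $k$ is strictly integrally positive definite with respect to $\mathcal M^*(X)$. (ii) $k$ is universal.
   Context: A kernel on $X$ is a symmetric positive definite function $k:X\times X\to\mathbb R$ (i.e. $\sum_{i,j}a_ia_jk(x_i,x_j)\ge0$ for all finite choices). $C_0(X)$ is the space of continuous real functions on $X$ vanishing at infinity, with the supremum norm $\|\cdot\|_\infty$. A $C_0(X)$-kernel is a bounded and continuous kernel $k$ on $X$ whose reproducing kernel Hilbert space $H$ satisfies $H\subset C_0(X)$. A continuous kernel $k$ with RKHS $H$ is universal if $H\subset C_0(X)$ and $H$ is dense in $C_0(X)$ with respect to $\|\cdot\|_\infty$. A finite measure $\nu$ on the Borel $\sigma$-algebra $\mathcal B(X)$ is a finite Radon measure if for all $B\in\mathcal B(X)$ one has $\nu(B)=\sup\{\nu(K):K\text{ compact},K\subset B\}=\inf\{\nu(O):O\text{ open},B\subset O\}$; $\mathcal M^*(X)$ is the space of finite signed Radon measures, i.e. differences of two finite Radon measures. The kernel $k$ is strictly integrally positive definite with respect to a set $\mathcal M$ of finite signed Borel measures if $\int\int k(x,x')\,\mathrm d\mu(x)\,\mathrm d\mu(x')>0$ for all $\mu\in\mathcal M$ with $\mu\ne0$; this double integral equals $\|\Phi(\mu)\|_H^2$, where $\Phi(\mu)=\int_Xk(\cdot,x)\,\mathrm d\mu(x)\in H$ (Pettis integral). *)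

(* Defs.v *)
From HB Require Import structures.
From mathcomp Require Import all_boot all_order all_algebra.
From mathcomp Require Import all_classical all_reals all_analysis.

Set Implicit Arguments.
Unset Strict Implicit.
Unset Printing Implicit Defensive.
Import Order.TTheory GRing.Theory Num.Theory.
Import numFieldNormedType.Exports.

Local Open Scope classical_set_scope.
Local Open Scope ring_scope.

(* [measurableType] is pointed, a topological space need not be: [borel x0] is
   [X] with its topology, its Borel sigma-algebra and the base point [x0].
   Nothing but the [Pointed] structure depends on [x0]. *)
Definition borel (X : topologicalType) (x0 : X) : Type := X.

HB.instance Definition _ (X : topologicalType) (x0 : X) :=
  Topological.on (borel x0).
HB.instance Definition _ (X : topologicalType) (x0 : X) :=
  isPointed.Build (borel x0) x0.
HB.instance Definition _ (X : topologicalType) (x0 : X) :=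
  @isMeasurable.Build (sigma_display (@open (borel x0))) (borel x0)
    <<s @open (borel x0) >> (@sigma_algebra0 _ setT _) (@sigma_algebraC _ _)
    (@sigma_algebra_bigcup _ setT _).

Section SignedMeasures.
Context {d : measure_display} {T : measurableType d} {R : realType}.

Definition hahn_sets (nu : {charge set T -> \bar R}) :
    {PN : set T * set T | hahn_decomposition nu PN.1 PN.2} :=
  cid (let: ex_intro P (ex_intro N h) := Hahn_decomposition nu in
       ex_intro _ (P, N) h).

(* The integral against nu^+ - nu^-, the Jordan decomposition of nu; it does not
   depend on the Hahn decomposition that is chosen. As for [Rintegral], the
   value is only meaningful for f integrable with respect to nu^+ and nu^-. *)
Definition charge_integral (nu : {charge set T -> \bar R}) (f : T -> R) : R :=
  Rintegral (jordan_pos (svalP (hahn_sets nu))) setT f -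
  Rintegral (jordan_neg (svalP (hahn_sets nu))) setT f.

(* mu <> 0 is tested on measurable sets: a charge is a function on all subsets
   of T, whose values outside the sigma-algebra are irrelevant. *)
Definition strictly_integrally_pd (k : T -> T -> R)
    (M : set ({charge set T -> \bar R})) : Prop :=
  forall mu, M mu -> (exists2 A, measurable A & mu A != 0%E) ->
    0 < charge_integral mu (fun x' => charge_integral mu (fun x => k x x')).

End SignedMeasures.

Section RadonMeasures.
Context {X : topologicalType} (x0 : X) (R : realType).

Definition finite_radon (nu : {finite_measure set (borel x0) -> \bar R}) : Prop :=
  forall B, measurable B ->
    nu B = ereal_sup [set nu K | K in [set K | compact K /\ K `<=` B]] /\
    nu B = ereal_inf [set nu O | O in [set O | open O /\ B `<=` O]].

Definition signed_radon : set ({charge set (borel x0) -> \bar R}) :=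
  [set nu | exists nu1 nu2 : {finite_measure set (borel x0) -> \bar R},
    [/\ finite_radon nu1, finite_radon nu2 &
        forall A, measurable A -> nu A = (nu1 A - nu2 A)%E]].

End RadonMeasures.
Arguments signed_radon {X} x0 R.

Section Kernels.
Context {R : realType}.

Definition kernel_function (X : Type) (k : X -> X -> R) : Prop :=
  (forall x y, k x y = k y x) /\
  (forall n (a : 'I_n -> R) (x : 'I_n -> X),
     0 <= \sum_(i < n) \sum_(j < n) a i * a j * k (x i) (x j)).

(* H, with the inner product dot, is a Hilbert space of functions on X having k
   as reproducing kernel. The values of dot outside H are irrelevant. *)
Record is_rkhs (X : Type) (k : X -> X -> R)
    (H : set (X -> R)) (dot : (X -> R) -> (X -> R) -> R) : Prop := {
  rkhs0 : H 0 ;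
  rkhsP : forall a f g, H f -> H g -> H (a *: f + g) ;
  rkhs_dotC : forall f g, H f -> H g -> dot f g = dot g f ;
  rkhs_dotP : forall a f g h, H f -> H g -> H h ->
    dot (a *: f + g) h = a * dot f h + dot g h ;
  rkhs_dot_gt0 : forall f, H f -> f <> 0 -> 0 < dot f f ;
  rkhs_complete : forall u : nat -> X -> R, (forall n, H (u n)) ->
    (forall e, 0 < e -> exists N, forall m n, (N <= m)%N -> (N <= n)%N ->
       Num.sqrt (dot (u m - u n) (u m - u n)) < e) ->
    exists2 f, H f & Num.sqrt (dot (u n - f) (u n - f)) @[n --> \oo] --> 0 ;
  rkhs_kernel : forall x, H (k^~ x) ;
  rkhs_reproducing : forall f x, H f -> f x = dot f (k^~ x)
}.

Definition sup_norm (X : Type) (f : X -> R) : R := sup (range (fun x => `|f x|)).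

Definition C0 (X : topologicalType) : set (X -> R) :=
  [set f | continuous f /\
           forall e, 0 < e -> compact [set x | e <= `|f x|]].

Definition continuous_kernel (X : topologicalType) (k : X -> X -> R) : Prop :=
  kernel_function k /\ continuous (fun z : X * X => k z.1 z.2).

(* In the next two definitions, H stands for the RKHS of k. *)
Definition C0_kernel (X : topologicalType) (k : X -> X -> R)
    (H : set (X -> R)) : Prop :=
  [/\ continuous_kernel k,
      exists M, forall x y, `|k x y| <= M &
      H `<=` @C0 X].

Definition universal_kernel (X : topologicalType) (k : X -> X -> R)
    (H : set (X -> R)) : Prop :=
  [/\ continuous_kernel k,
      H `<=` @C0 X &
      forall g, C0 g -> forall e, 0 < e -> exists2 f, H f & sup_norm (g - f) < e].

End Kernels.

(* Main.v *)
(** For a signed Radon measure mu = nu1 - nu2, integration against mu is a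
    bounded linear functional L on H, so by Riesz representation L = <., h> for
    some h in H; then h = Phi(mu) and the double integral of k is
    L h = ||h||^2. It is positive unless L vanishes on H. If H is dense in
    C0(X), then L = 0 on H forces L = 0 on C0(X), hence nu1 = nu2 by Urysohn's
    lemma and regularity. If H is not dense, Hahn-Banach gives a bounded
    functional on C0(X) vanishing on H but not on C0(X); by the
    Riesz-Markov theorem it is integration against a nonzero signed Radon
    measure, whose double integral is 0. *)

Require Import Defs.
From HB Require Import structures.
From mathcomp Require Import all_boot all_order all_algebra.
From mathcomp Require Import all_classical all_reals all_analysis.
From mathcomp Require Import lra ring.

Set Implicit Arguments.
Unset Strict Implicit.
Unset Printing Implicit Defensive.
Import Order.TTheory GRing.Theory Num.Theory.
Import numFieldNormedType.Exports.

Local Open Scope classical_set_scope.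
Local Open Scope ring_scope.

(** * Functions vanishing at infinity *)

(** Riesz-Markov turns positive functionals into positive measures, whereas a functional that
    annihilates [H] has no sign. Instead of being decomposed afterwards, it is sought on pairs of
    functions and dominated by a multiple of the supremum of the positive part: this domination
    alone makes both halves of the extension positive and bounded. Since [X] need not be
    sigma-compact, mass is not computed along an exhausting sequence. Each competitor function is
    cut at a small height instead, so that it lives on a compact superlevel set, at an arbitrarily
    small cost. The iterated integral requires neither joint measurability nor an exchange of
    integrals: the inner integral, as a function of [x'], is identified with an element of [H],
    namely zero in one direction and the representer in the other. The outer integral is therefore
    again that of a [C0] function. *)

Section C0_theory.
Context {R : realType} {X : topologicalType}.
Implicit Types f g h : X -> R.

Lemma C0_sub_compact g : continuous g ->
  (forall e, 0 < e -> exists2 K, compact K & [set x | e <= `|g x|] `<=` K) ->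
  C0 g.
Proof.
move=> cg gK; split => // e e0; have [K cK sK] := gK e e0.
apply: subclosed_compact cK sK.
have -> : [set x | e <= `|g x|] = (fun x => `|g x|) @^-1` [set r | e <= r] by [].
apply: preimage_closed; last exact: closed_ge.
by move=> x _; apply: (@continuous_comp _ _ _ g (fun r : R => `|r|)); [exact: cg|exact: norm_continuous].
Qed.

Lemma C0_dominated g f : C0 f -> continuous g -> (forall x, `|g x| <= `|f x|) -> C0 g.
Proof.
move=> [cf kf] cg gf; apply: C0_sub_compact => // e e0.
by exists [set x | e <= `|f x|]; [exact: kf|move=> x /= /le_trans; exact].
Qed.

Lemma C0_0 : C0 (0 : X -> R).
Proof.
apply: C0_sub_compact; first exact: cst_continuous.
move=> e e0; exists set0; first exact: compact0.
by move=> x /=; rewrite normr0 leNgt e0.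
Qed.

Lemma C0_lin (a : R) f g : C0 f -> C0 g -> C0 (a *: f + g).
Proof.
move=> [cf kf] [cg kg]; apply: C0_sub_compact.
  move=> x; apply: (@continuousD R R^o _ (a *: f) g); last exact: cg.
  by apply: (@continuousM _ _ (cst a) f); [exact: cst_continuous|exact: cf].
move=> e e0; pose b := `|a| + 1; have b0 : 0 < b by rewrite ltr_wpDl.
exists ([set x | e / 2 / b <= `|f x|] `|` [set x | e / 2 <= `|g x|]).
  by apply: compactU; [apply: kf|apply: kg]; rewrite !divr_gt0.
move=> x /= ex; case: (lerP (e / 2) `|g x|) => [|gx]; [by right|left].
rewrite ler_pdivrMr//.
have : e <= `|a| * `|f x| + `|g x|.
  by rewrite -normrM (le_trans ex)//; exact: ler_normD.
have : `|f x| * b = `|a| * `|f x| + `|f x| by rewrite /b; ring.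
have := normr_ge0 (f x); lra.
Qed.

Lemma C0_scale (a : R) f : C0 f -> C0 (a *: f).
Proof. by move=> /(C0_lin a) /(_ C0_0); rewrite addr0. Qed.

Lemma C0_add f g : C0 f -> C0 g -> C0 (f + g).
Proof. by move=> /(C0_lin 1) /[apply]; rewrite scale1r. Qed.

Lemma C0_sub f g : C0 f -> C0 g -> C0 (f - g).
Proof. by move=> fc gc; rewrite addrC -scaleN1r; exact: C0_lin. Qed.

Lemma C0_max f g : C0 f -> C0 g -> C0 (f \max g).
Proof.
move=> [cf kf] [cg kg]; apply: C0_sub_compact; first exact: max_fun_continuous.
move=> e e0; exists ([set x | e <= `|f x|] `|` [set x | e <= `|g x|]).
  by apply: compactU; [apply: kf|apply: kg].
by move=> x /=; rewrite /Num.max; case: ifP; [right|left].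
Qed.

Lemma C0_bounded f : C0 f -> exists2 M, 0 <= M & forall x, `|f x| <= M.
Proof.
move=> [cf kf]; have k1 := kf 1 ltr01.
have : compact (f @` [set x | 1 <= `|f x|]).
  by apply: continuous_compact => //; exact: continuous_subspaceT.
move=> /(@compact_bounded R R^o) [M [_ bM]].
exists (`|M| + 1) => [|x]; first by rewrite addr_ge0.
case: (lerP 1 `|f x|) => fx.
  apply: (bM (`|M| + 1)); last by exists x.
  by rewrite (le_lt_trans (ler_norm M))// ltrDl.
by rewrite (le_trans (ltW fx))// lerDr.
Qed.

Lemma C0_trunc f (c : R) : 0 <= c -> C0 f -> C0 (f \min cst c).
Proof.
move=> c0 fc; apply: (C0_dominated fc).
  by apply: min_fun_continuous; [exact: fc.1|exact: cst_continuous].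
move=> x /=; rewrite /Num.min; case: ifPn => //; rewrite -leNgt => cf.
by rewrite ger0_norm// (le_trans cf)// ler_norm.
Qed.

(** Near-covering compactness, applied to the filter on [I] generated by the tails of the preorder
    given by inclusion between the [P i]; directedness makes these tails a filter base. *)
Lemma compact_directed_cover (I : Type) (P : I -> set X) (K : set X) (i0 : I) :
  compact K -> (forall i j, exists k, P i `|` P j `<=` P k) ->
  (forall x, K x -> exists i, nbhs x (P i)) -> exists i, K `<=` P i.
Proof.
move=> /compact_near_coveringP cK dP KP.
pose F : set_system I := [set S | exists i, [set j | P i `<=` P j] `<=` S].
have FF : Filter F.
  split.
  - by exists i0.
  - move=> S T [i iS] [j jT]; have [k ijk] := dP i j; exists k => l kl.
    split; [apply: iS|apply: jT] => /=; apply: subset_trans kl;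
      apply: subset_trans ijk; [exact: subsetUl|exact: subsetUr].
  - by move=> S T ST [i iS]; exists i; exact: subset_trans ST.
have [|i iK] := cK I F (fun i x => P i x) FF.
- move=> x Kx; have [i Pi] := KP x Kx.
  exists (P i, [set j | P i `<=` P j]); first by split => //; exists i.
  by move=> [y j] /= [Piy]; exact.
- by exists i; apply: iK => /=.
Qed.

Hypothesis hausdorffX : hausdorff_space X.
Hypothesis lcX : locally_compact [set: X].

(** Complete regularity separates [x] from the complement of [O] met with the interior of a compact
    neighbourhood. The function then vanishes off that neighbourhood, which puts it in [C0]. *)
Lemma Urysohn_point (x : X) (O : set X) : open O -> O x ->
  exists h : X -> R, [/\ C0 h, forall y, 0 <= h y <= 1, h x = 1 &
    forall y, ~ O y -> h y = 0].
Proof.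
move=> oO Ox; have [U] := lcX (x := x) Logic.I.
rewrite withinET => Ux [cU clU].
pose B := ~` (O `&` U°).
have clB : closed B by apply: open_closedC; apply: openI => //; exact: open_interior.
have nBx : ~ B x by move=> /=; apply; split.
have := locally_compact_completely_regular (R := R) lcX hausdorffX clB nBx.
move=> /(@uniform_separatorP _ R)[f [cf f01 fx fB]].
have cg : continuous (fun y => 1 - f y).
  by move=> y; apply: (@continuousB R R^o _ (cst 1) f); [exact: cst_continuous|exact: cf].
have f01' y : 0 <= f y <= 1.
  by have := f01 (f y); rewrite /= in_itv/=; apply; exists y.
exists (fun y => 1 - f y); split.
- apply: C0_sub_compact => // e e0; exists U => //.
  move=> y /= ey; apply: contrapT => nUy.
  have : f y = 1 by apply: fB; exists y => // -[_ /interior_subset].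
  by move=> fy; move: ey; rewrite fy subrr normr0 leNgt e0.
- by move=> y; have /andP[f0 f1] := f01' y; rewrite subr_ge0 f1 gerBl.
- by rewrite (fx (f x)) ?subr0//; exists x.
- by move=> y nOy; rewrite (fB (f y)) ?subrr//; exists y => // -[].
Qed.

(** The functions in [Q] are stable under maxima, so the sets where they exceed [1/2] are directed
    and one of them contains [K]. Doubling and truncating at [1] then gives the value [1] on [K]. *)
Lemma Urysohn_compact (K O : set X) : compact K -> open O -> K `<=` O ->
  exists h : X -> R, [/\ C0 h, forall y, 0 <= h y <= 1,
    forall y, K y -> h y = 1 & forall y, ~ O y -> h y = 0].
Proof.
move=> cK oO KO.
pose Q (h : X -> R) :=
  [/\ C0 h, forall y, 0 <= h y <= 1 & forall y, ~ O y -> h y = 0].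
pose I := {h : X -> R | Q h}.
pose P (i : I) : set X := [set x | 2^-1 < sval i x].
have i0 : I.
  by exists 0; split => //; [exact: C0_0|move=> y; rewrite lexx ler01].
have [||[h [hc h01 hO]] /= hK] := @compact_directed_cover I P K i0 cK.
- move=> [f [fc f01 fO]] [g [gc g01 gO]].
  have mQ : Q (f \max g).
    split; first exact: C0_max.
    - by move=> y; rewrite /= /Num.max; case: ifP.
    - by move=> y nOy; rewrite /= fO// gO// maxxx.
  exists (exist Q _ mQ) => y; rewrite /P/= lt_max.
  by move=> [->//|->]; rewrite orbT.
- move=> x /KO Ox; have [h [hc h01 hx hO]] := Urysohn_point oO Ox.
  have hQ : Q h by [].
  exists (exist Q h hQ); rewrite /P/=.
  have : nbhs (h x) [set r : R | 2^-1 < r].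
    by apply: lt_nbhsr; rewrite hx; lra.
  exact: hc.1.
- exists ((2 *: h) \min cst 1); split.
  + by apply: C0_trunc => //; exact: C0_scale.
  + move=> y /=; have /andP[h0 h1] := h01 y.
    rewrite ge_min lexx orbT andbT le_min ler01 andbT.
    by rewrite mulr_ge0.
  + move=> y /hK /=; rewrite /P/= => hy; apply/min_idPr.
    by change (1 <= 2 * h y); lra.
  + move=> y nOy; change (Num.min (2 * h y) 1 = 0).
    by rewrite hO// mulr0 min_l.
Qed.

End C0_theory.

(** * Integrals of functions vanishing at infinity *)

Section C0_integral.
Context {R : realType} {X : topologicalType} (x0 : X).
Implicit Types (f g h : X -> R) (U K : set X).

Lemma open_borel U : open U -> measurable (U : set (borel x0)).
Proof. exact: sub_sigma_algebra. Qed.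

Lemma compact_borel U : hausdorff_space X -> compact U -> measurable (U : set (borel x0)).
Proof.
move=> hX cU; rewrite -(setCK U); apply: measurableC; apply: open_borel.
by apply: closed_openC; exact: compact_closed.
Qed.

Lemma continuous_borel f : continuous f -> measurable_fun [set: borel x0] f.
Proof.
move=> /continuousP cf; apply: (measurability _ (measurable_realfun.RGenOpens.measurableE R)).
move=> _ [_ [a [b ->] <-]]; rewrite setTI; apply: open_borel.
exact/cf/interval_open.
Qed.

Variable nu : {finite_measure set (borel x0) -> \bar R}.

Let I f : R := Rintegral nu setT f.
Let m (U : set X) : R := fine (nu U).

Lemma C0_integrable f : C0 f -> nu.-integrable setT (EFin \o (f : borel x0 -> R)).
Proof.
move=> fc; apply: measurable_bounded_integrable => //.
- by rewrite -ge0_fin_numE// fin_num_measure.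
- exact: continuous_borel fc.1.
- have [M _ fM] := C0_bounded fc.
  by exists M; split; [exact: num_real|move=> r Mr x _; exact: le_trans (fM x) (ltW Mr)].
Qed.

Lemma Rintegral_C0_lin a f g : C0 f -> C0 g -> I (a *: f + g) = a * I f + I g.
Proof.
move=> fc gc; rewrite /I -RintegralZl//; last exact: C0_integrable.
rewrite -RintegralD//; last exact: C0_integrable.
exact: (C0_integrable (C0_scale a fc)).
Qed.

Let integrable_indic U : measurable (U : set (borel x0)) ->
  nu.-integrable setT (EFin \o (\1_U : borel x0 -> R)).
Proof.
move=> mU; apply: measurable_bounded_integrable => //.
- by rewrite -ge0_fin_numE// fin_num_measure.
- exists 1; split; first exact: num_real.
  move=> r r1 x _ /=; rewrite indicE (le_trans _ (ltW r1))//.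
  by case: (_ \in _); rewrite ?normr1 ?normr0 ?ler01.
Qed.

Let Rintegral_indic U : measurable (U : set (borel x0)) -> I \1_U = m U.
Proof. by move=> mU; rewrite /I /Rintegral integral_indic// setIT. Qed.

Lemma Rintegral_le_measure U h : measurable (U : set (borel x0)) -> C0 h ->
  (forall x, h x <= 1) -> (forall x, ~ U x -> h x = 0) -> I h <= m U.
Proof.
move=> mU hc h1 hU; rewrite -Rintegral_indic//; apply: le_Rintegral => //.
- exact: C0_integrable.
- exact: integrable_indic.
- move=> x _ /=; have [Ux|nUx] := pselect (U x); first by rewrite mem_set.
  by rewrite memNset// hU.
Qed.

Lemma measure_le_Rintegral U h : measurable (U : set (borel x0)) -> C0 h ->
  (forall x, 0 <= h x) -> (forall x, U x -> 1 <= h x) -> m U <= I h.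
Proof.
move=> mU hc h0 hU; rewrite -Rintegral_indic//; apply: le_Rintegral => //.
- exact: integrable_indic.
- exact: C0_integrable.
- move=> x _ /=; have [Ux|nUx] := pselect (U x); last by rewrite memNset.
  by rewrite mem_set// hU.
Qed.

Lemma normr_Rintegral_C0 f M : C0 f -> (forall x, `|f x| <= M) ->
  `|I f| <= M * m setT.
Proof.
move=> fc fM; apply: (le_trans (le_normr_Rintegral _ (C0_integrable fc))) => //.
rewrite -[leRHS]Rintegral_cst//; apply: le_Rintegral => //.
- exact: integrable_norm (C0_integrable fc).
- apply: measurable_bounded_integrable => //.
    by rewrite -ge0_fin_numE// fin_num_measure.
  by exists `|M|; split; [exact: num_real|move=> r Mr x _; exact: ltW].
Qed.

End C0_integral.

(** * Comparison of functionals through superlevel sets *)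

Section layers.
Context {R : realType} {X : topologicalType}.
(** [m] measures open sets, bounding [I] from above and [I'] from below. The two roles are separated
    so that the comparison can be used in both directions, with a functional and the integral
    exchanged. *)
Variables (I I' : (X -> R) -> R) (m : set X -> R) (C : R).
Hypothesis I_lin : forall a f g, C0 f -> C0 g -> I (a *: f + g) = a * I f + I g.
Hypothesis I'_lin : forall a f g, C0 f -> C0 g -> I' (a *: f + g) = a * I' f + I' g.
Hypothesis m_ge0 : forall U, 0 <= m U.
Hypothesis m_leC : forall U, m U <= C.
Hypothesis I_le : forall (U : set X) h, open U -> C0 h -> (forall x, 0 <= h x <= 1) ->
  (forall x, ~ U x -> h x = 0) -> I h <= m U.
Hypothesis I'_ge : forall (U : set X) h, open U -> C0 h -> (forall x, 0 <= h x <= 1) ->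
  (forall x, U x -> h x = 1) -> m U <= I' h.

(* [n f] is the sum of [n] functions lying between the indicators of the sets
   [f > (j + 1) / n] and [f > j / n] for [j < n]; the two resulting sums of
   measures telescope to a difference of at most [C]. *)
Lemma layer_cake_le f : C0 f -> (forall x, 0 <= f x <= 1) -> I f <= I' f.
Proof.
move=> fc f01; apply/ler_addgt0Pl => e e0.
have [n Cn] : exists n : nat, C / n.+1%:R < e.
  pose n := Num.bound (C / e); exists n.
  rewrite ltr_pdivrMr// mulrC -ltr_pdivrMr//.
  have C0e : 0 <= C / e by rewrite divr_ge0 ?(ltW e0)// (le_trans (m_ge0 set0)).
  by rewrite (lt_trans (archi_boundP C0e))// ltr_nat.
pose N : R := n.+1%:R; have N0 : 0 < N by rewrite ltr0n.
pose trunc (j : nat) : X -> R := f \min cst (j%:R / N).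
have truncC j : C0 (trunc j) by apply: C0_trunc => //; rewrite divr_ge0// ltW.
pose layer j : X -> R := N *: (trunc j.+1 - trunc j).
have layerE j x : layer j x = N * (Num.min (f x) (j.+1%:R / N) - Num.min (f x) (j%:R / N)) by [].
have layerC j : C0 (layer j) by apply: C0_scale; exact: C0_sub.
pose U j : set X := [set x | j%:R / N < f x].
have oU j : open (U j).
  have -> : U j = f @^-1` [set r | j%:R / N < r] by [].
  by apply: open_comp; [move=> x _; exact: fc.1|exact: open_gt].
have jN j : j.+1%:R / N = j%:R / N + N^-1 by rewrite -addn1 natrD mulrDl mul1r.
have layer01 j x : 0 <= layer j x <= 1.
  rewrite layerE jN; apply/andP; split.
    apply: mulr_ge0; first exact: ltW.
    by rewrite subr_ge0 le_min !ge_min lexx/= lerDl invr_ge0 (ltW N0) orbT.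
  rewrite -ler_pdivlMl// mulr1.
  have Ni : 0 < N^-1 by rewrite invr_gt0.
  move: (j%:R / N) => a; move: (N^-1) Ni => d d0.
  by have [?|?] := leP (f x) a; have [?|?] := leP (f x) (a + d); lra.
have layer0 j x : ~ U j x -> layer j x = 0.
  move=> /negP; rewrite -leNgt => fj; rewrite layerE jN min_l; last first.
    by rewrite (le_trans fj)// lerDl invr_ge0 ltW.
  by rewrite min_l// subrr mulr0.
have layer1 j x : U j.+1 x -> layer j x = 1.
  move=> fj; have := fj; rewrite /U/= jN => fj'.
  rewrite layerE min_r; last exact: ltW.
  rewrite min_r; last by rewrite (le_trans _ (ltW fj'))// lerDl invr_ge0 ltW.
  by rewrite jN addrC addKr mulfV// gt_eqF.
have truncN : trunc n.+1 = f.
  apply/funext => x; rewrite /trunc /= mulfV ?gt_eqF// min_l//.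
  by have /andP[] := f01 x.
have trunc0 : trunc 0 = 0.
  apply/funext => x; rewrite /trunc /= mul0r min_r//.
  by have /andP[] := f01 x.
have sum_layer (L : (X -> R) -> R) :
    (forall a f g, C0 f -> C0 g -> L (a *: f + g) = a * L f + L g) ->
    N * L f = \sum_(0 <= j < n.+1) L (layer j).
  move=> L_lin.
  have L0 : L 0 = 0.
    by have := L_lin (-1) _ _ C0_0 C0_0; rewrite scaler0 addr0; lra.
  have LE j : L (layer j) = N * L (trunc j.+1) - N * L (trunc j).
    have := L_lin N (trunc j.+1 - trunc j) 0 (C0_sub (truncC _) (truncC _)) C0_0.
    rewrite addr0 L0 addr0 => ->; rewrite addrC -scaleN1r L_lin//; ring.
  rewrite (eq_bigr _ (fun j _ => LE j)) telescope_sumr//.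
  by rewrite truncN trunc0 L0 mulr0 subr0.
have If : N * I f <= \sum_(0 <= j < n.+1) m (U j).
  rewrite sum_layer//; apply: ler_sum => j _; apply: I_le => //.
  exact: layer0.
have I'f : \sum_(0 <= j < n.+1) m (U j.+1) <= N * I' f.
  rewrite sum_layer//; apply: ler_sum => j _; apply: I'_ge => //.
  exact: layer1.
have mU : \sum_(0 <= j < n.+1) m (U j) - \sum_(0 <= j < n.+1) m (U j.+1) <= C.
  rewrite -sumrB (eq_bigr (fun j => - m (U j.+1) - - m (U j))); last first.
    by move=> j _; rewrite opprK addrC.
  rewrite telescope_sumr// opprK addrC.
  by have := m_leC (U 0%N); have := m_ge0 (U n.+1); lra.
rewrite -(ler_pM2l N0) mulrDr; move: Cn; rewrite ltr_pdivrMr// -/N => Cn.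
by move: If I'f mU Cn; rewrite (mulrC e); lra.
Qed.

End layers.

(** Positive and negative parts are scaled into [[0, 1]] by a bound of [f]; the [1] added to this
    bound keeps the factor invertible when [f] is zero. *)
Lemma C0_lin_ext {R : realType} {X : topologicalType} (I I' : (X -> R) -> R) :
  (forall a f g, C0 f -> C0 g -> I (a *: f + g) = a * I f + I g) ->
  (forall a f g, C0 f -> C0 g -> I' (a *: f + g) = a * I' f + I' g) ->
  (forall f, C0 f -> (forall x, 0 <= f x <= 1) -> I f = I' f) ->
  forall f, C0 f -> I f = I' f.
Proof.
move=> I_lin I'_lin II' f fc; have [M M0 fM] := C0_bounded fc.
pose c := M + 1; have c0 : 0 < c by rewrite ltr_wpDl.
have pos g : C0 g -> (forall x, 0 <= c^-1 * g x <= 1) -> I g = I' g.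
  move=> gc g01; have eqg : I (c^-1 *: g + 0) = I' (c^-1 *: g + 0).
    by rewrite addr0; apply: II' => //; exact: C0_scale.
  have eq0 : I 0 = I' 0 by apply: II' => [|x]; [exact: C0_0|rewrite lexx ler01].
  move: eqg; rewrite I_lin ?I'_lin//; [|exact: C0_0..].
  by rewrite eq0 => /addIr /mulfI; apply; rewrite invr_eq0 gt_eqF.
pose g := f \max 0; have gc : C0 g by apply: C0_max => //; exact: C0_0.
have fE : f = (-1) *: (g - f) + g.
  by rewrite scaleN1r opprB subrK.
have fb x : - M <= f x <= M by rewrite -ler_norml.
have bnd x : 0 <= c^-1 * g x <= 1 /\ 0 <= c^-1 * (g - f) x <= 1.
  rewrite -[g x]/(Num.max (f x) 0) -[(_ - _) x]/(Num.max (f x) 0 - f x).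
  have /andP[fl fr] := fb x; rewrite !mulr_ge0 ?invr_ge0 ?(ltW c0)//=.
  - rewrite !ler_pdivrMl// mulr1 /c.
    by split; have [?|?] := leP (f x) 0; lra.
  - by rewrite subr_ge0 le_max lexx.
  - by rewrite le_max lexx orbT.
have gfc : C0 (g - f) by exact: C0_sub.
rewrite fE I_lin// I'_lin// (pos _ gc) ?(pos _ gfc)// => x; by have [] := bnd x.
Qed.

(** * The Riesz-Markov theorem for C0(X) *)

Section riesz_markov.
Context {R : realType} {X : topologicalType}.
Hypothesis hausdorffX : hausdorff_space X.
Hypothesis lcX : locally_compact [set: X].
Variables (J : (X -> R) -> R) (C : R).
Hypothesis J_lin : forall a f g, C0 f -> C0 g -> J (a *: f + g) = a * J f + J g.
Hypothesis J_ge0 : forall f, C0 f -> (forall x, 0 <= f x) -> 0 <= J f.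
Hypothesis J_le : forall f, C0 f -> (forall x, f x <= 1) -> J f <= C.

Let C00 := @C0_0 R X.

Let J0 : J 0 = 0.
Proof. by have := J_lin (-1) C00 C00; rewrite scaler0 addr0; lra. Qed.

Let C_ge0 : 0 <= C.
Proof. by rewrite -J0; apply: J_le. Qed.

Let JD f g : C0 f -> C0 g -> J (f + g) = J f + J g.
Proof. by move=> /(J_lin 1) /[apply]; rewrite scale1r mul1r. Qed.

Let JZ a f : C0 f -> J (a *: f) = a * J f.
Proof. by move=> /(J_lin a) /(_ C00); rewrite !addr0 J0 addr0. Qed.

Let JB f g : C0 f -> C0 g -> J (f - g) = J f - J g.
Proof. by move=> fc gc; rewrite addrC -scaleN1r J_lin// mulN1r addrC. Qed.

Let J_mono f g : C0 f -> C0 g -> (forall x, f x <= g x) -> J f <= J g.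
Proof.
move=> fc gc fg; rewrite -subr_ge0 -JB//; apply: J_ge0; first exact: C0_sub.
by move=> x; rewrite -[_ x]/(g x - f x) subr_ge0.
Qed.

(** Competitors only have to vanish outside [U], a weaker condition than compact support inside [U].
    It is easy to check for sums and minima, and [J_cut] recovers compactness when it matters. *)
Let adm (U : set X) : set (X -> R) :=
  [set f | [/\ C0 f, forall x, 0 <= f x <= 1 & forall x, ~ U x -> f x = 0]].

Let adm_le U V f : U `<=` V -> adm U f -> adm V f.
Proof. by move=> UV [fc f01 fU]; split => // x nVx; apply: fU => /UV. Qed.

Let adm0 U : adm U 0.
Proof. by split => // x; rewrite lexx ler01. Qed.

Let inner (U : set X) : R := sup [set J f | f in adm U].

Let has_sup_inner U : has_sup [set J f | f in adm U].
Proof.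
split; first by exists (J 0), 0 => //; exact: adm0.
by exists C => _ [f [fc f01 _] <-]; apply: J_le => // x; have /andP[] := f01 x.
Qed.

Let J_inner U f : adm U f -> J f <= inner U.
Proof.
by move=> Uf; apply: (sup_upper_bound (has_sup_inner U)); exists f.
Qed.

Let inner_le U r : (forall f, adm U f -> J f <= r) -> inner U <= r.
Proof.
move=> Ur; apply: ge_sup; first exact: (has_sup_inner U).1.
by move=> _ [f Uf <-]; exact: Ur.
Qed.

Let inner_ge0 U : 0 <= inner U.
Proof. by rewrite -J0; apply: J_inner; exact: adm0. Qed.

Let inner_leC U : inner U <= C.
Proof.
by apply: inner_le => f [fc f01 _]; apply: J_le => // x; have /andP[] := f01 x.
Qed.

Let inner_mono U V : U `<=` V -> inner U <= inner V.
Proof. by move=> UV; apply: inner_le => f /(adm_le UV); exact: J_inner. Qed.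

Let inner0 : inner set0 = 0.
Proof.
apply/eqP; rewrite eq_le inner_ge0 andbT; apply: inner_le => f [_ _ f0].
by rewrite (_ : f = 0) ?J0//; apply/funext => x; exact: f0.
Qed.

(* Cutting [f] at a small height [e] makes its support compact: [f - min f e]
   vanishes outside the compact set [f >= e], and costs at most [C * e]. *)
Let J_cut U f d : 0 < d -> adm U f ->
  exists e, [/\ 0 < e, adm U (f - (f \min cst e)),
    forall x, f x < e -> (f - (f \min cst e)) x = 0 &
    J f <= J (f - (f \min cst e)) + d].
Proof.
move=> d0 [fc f01 fU]; have C1 : 0 < C + 1 by rewrite ltr_wpDl.
pose e : R := d / (C + 1); have e0 : 0 < e by rewrite divr_gt0.
have mc : C0 (f \min cst e) by apply: C0_trunc => //; exact: ltW.
have cutE (x : X) : (f - (f \min cst e)) x = f x - Num.min (f x) e by [].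
exists e; split => //.
- split; first exact: C0_sub.
  + move=> x; rewrite cutE; have /andP[f0 f1] := f01 x.
    by rewrite subr_ge0 ge_min lexx/= (le_trans _ f1)// gerBl le_min f0 ltW.
  + by move=> x nUx; rewrite cutE fU// min_l ?subrr// ltW.
- by move=> x fe; rewrite cutE min_l ?subrr// ltW.
- rewrite JB//; suff : J (f \min cst e) <= d by lra.
  have : J (e^-1 *: (f \min cst e)) <= C.
    apply: J_le; first exact: C0_scale.
    by move=> x; rewrite -[_ x]/(e^-1 * Num.min (f x) e) ler_pdivrMl// mulr1 ge_min lexx orbT.
  rewrite JZ// ler_pdivrMl// => /le_trans; apply.
  by rewrite /e -mulrA ler_piMr ?(ltW d0)// ler_pdivrMl// mulr1 lerDl.
Qed.

Let adm_compact f U e : adm U f -> 0 < e -> compact [set x | e <= f x].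
Proof.
move=> [[cf kf] f01 _] e0; have := kf e e0.
suff -> : [set x | e <= `|f x|] = [set x | e <= f x] by [].
apply/seteqP; split => x /=; have /andP[f0 _] := f01 x; by rewrite ger0_norm.
Qed.

(** A two-set partition of unity. The support of the cut function [g] outside [V] lies in a compact
    subset of [U], where a Urysohn function [h] equals [1]; hence [g \min h] lives in [U] and the
    remainder of [g] in [V]. *)
Let inner_setU U V : open U -> open V -> inner (U `|` V) <= inner U + inner V.
Proof.
move=> oU oV; apply: inner_le => f Uf; apply/ler_addgt0Pl => d d0.
have [e [e0 [gc g01 gUV] g0 Jfg]] := J_cut d0 Uf.
set g := f - (f \min cst e) in gc g01 gUV g0 Jfg.
pose K := [set x | e <= f x].
have cKV : compact (K `&` ~` V).
  by apply: compact_closedI; [exact: adm_compact Uf e0|exact: open_closedC].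
have [] := @Urysohn_compact R X hausdorffX lcX _ U cKV oU.
  move=> x [Kx nVx]; apply: contrapT => nUx; have [_ _ /(_ x)] := Uf.
  have -> : f x = 0 by have [_ _] := Uf; apply => -[].
  by move: Kx; rewrite /K/=; have [_ _ ->] := Uf; [rewrite leNgt e0|case].
move=> h [hc h01 hK hU].
have gh : adm U (g \min h).
  split.
  - apply: (C0_dominated gc); first by apply: min_fun_continuous; [exact: gc.1|exact: hc.1].
    move=> x /=; have /andP[g0x _] := g01 x; have /andP[h0x _] := h01 x.
    by rewrite !ger0_norm// ?le_min ?g0x// ge_min lexx.
  - move=> x /=; have /andP[g0x g1x] := g01 x; have /andP[h0x _] := h01 x.
    by rewrite le_min g0x h0x/= ge_min g1x.
  - by move=> x nUx /=; rewrite hU// min_r//; have /andP[] := g01 x.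
have gV : adm V (g - (g \min h)).
  have gE x : (g - (g \min h)) x = g x - Num.min (g x) (h x) by [].
  split; first by apply: C0_sub => //; case: gh.
  - move=> x; rewrite gE; have /andP[g0x g1x] := g01 x; have /andP[h0x _] := h01 x.
    by rewrite subr_ge0 ge_min lexx/= (le_trans _ g1x)// gerBl le_min g0x.
  - move=> x nVx; rewrite gE; have [fe|ef] := ltP (f x) e.
      by rewrite g0// min_l ?subrr//; have /andP[] := h01 x.
    by rewrite min_l ?subrr// hK//; have /andP[] := g01 x.
apply: (le_trans Jfg); rewrite addrC lerD//.
rewrite -(subrK (g \min h) g) JD; [|by case: gV|by case: gh].
by rewrite addrC lerD//; exact: J_inner.
Qed.

(** The cut competitor lives on a compact set, which finitely many of the [U n] already cover; this
    reduces the series to its partial sums. *)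
Let inner_bigcup (U : (set X)^nat) : (forall n, open (U n)) ->
  ((inner (\bigcup_n U n))%:E <= \sum_(n <oo) (inner (U n))%:E)%E.
Proof.
move=> oU.
have fin n : inner (\big[setU/set0]_(i < n) U i) <= \sum_(i < n) inner (U i).
  elim: n => [|n ih]; first by rewrite !big_ord0 inner0.
  rewrite !big_ord_recr/= (le_trans (inner_setU _ (oU n)))//.
    by apply: big_ind => //; [exact: open0|exact: openU].
  by rewrite lerD2r.
have fin' n : ((inner (\big[setU/set0]_(i < n) U i))%:E <= \sum_(n <oo) (inner (U n))%:E)%E.
  apply: le_trans (nneseries_lim_ge n _); last by move=> i _; rewrite lee_fin.
  by rewrite big_mkord sumEFin lee_fin.
have : (0 <= \sum_(n <oo) (inner (U n))%:E)%E.
  by apply: nneseries_ge0 => i _; rewrite lee_fin.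
(* [inner_le] compares with a real number, so the value of the series is split: [+oo] is immediate
   and [-oo] contradicts non-negativity. *)
move: fin'; case: (limn _) => [s| |] fin'; last 2 first.
- by move=> _; rewrite leey.
- by rewrite leeNy_eq.
move=> _; rewrite lee_fin; apply: inner_le => f Uf.
apply/ler_addgt0Pl => d d0.
have [e [e0 [gc g01 gUV] g0 Jfg]] := J_cut d0 Uf.
have [||n Kn] := @compact_directed_cover X nat (fun n => \big[setU/set0]_(i < n) U i)
    [set x | e <= f x] 0 (adm_compact Uf e0).
- move=> i j; exists (maxn i j).
  by rewrite subUset; split; apply: subset_bigsetU; [exact: leq_maxl|exact: leq_maxr].
- move=> x /= ex.
  have [n _ Unx] : (\bigcup_n U n) x.
    by apply: contrapT => nUx; have [_ _ f0] := Uf; move: ex; rewrite f0// leNgt e0.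
  exists n.+1; apply: open_nbhs_nbhs; split.
    by apply: big_ind => //; [exact: open0|exact: openU].
  by rewrite big_ord_recr; right.
apply: (le_trans Jfg); rewrite addrC lerD//.
have := fin' n; rewrite lee_fin; apply: le_trans; apply: J_inner.
split => // x nUx; have [fe|ef] := ltP (f x) e; first exact: g0.
by exfalso; apply: nUx; exact: Kn.
Qed.

(** Extending from open sets by an infimum builds outer regularity into the measure; inner
    regularity is then the half that needs an argument. *)
Let outer (A : set X) : R := inf [set inner U | U in [set U | open U /\ A `<=` U]].

Let has_inf_outer A : has_inf [set inner U | U in [set U | open U /\ A `<=` U]].
Proof.
split; first by exists (inner setT), setT => //; split => //; exact: openT.
by exists 0 => _ [U _ <-]; exact: inner_ge0.
Qed.

Let outer_inner A U : open U -> A `<=` U -> outer A <= inner U.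
Proof.
move=> oU AU; apply: (ge_inf (has_inf_outer A).2).
by exists U.
Qed.

Let le_outer A r : (forall U, open U -> A `<=` U -> r <= inner U) -> r <= outer A.
Proof.
move=> Ur; apply: lb_le_inf; first exact: (has_inf_outer A).1.
by move=> _ [U [oU AU] <-]; exact: Ur.
Qed.

Let outer_adherent A e : 0 < e ->
  exists U, [/\ open U, A `<=` U & inner U < outer A + e].
Proof.
move=> e0; have [_ [U [oU AU] <-] Ue] := inf_adherent e0 (has_inf_outer A).
by exists U.
Qed.

Let outer_open U : open U -> outer U = inner U.
Proof.
move=> oU; apply/eqP; rewrite eq_le outer_inner//=.
by apply: le_outer => V oV; exact: inner_mono.
Qed.

Let outer_ge0 A : 0 <= outer A. Proof. exact: le_outer. Qed.

Let outer_mono A B : A `<=` B -> outer A <= outer B.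
Proof.
by move=> AB; apply: le_outer => U oU BU; apply: outer_inner => //; exact: subset_trans BU.
Qed.

Let mu (A : set X) : \bar R := (outer A)%:E.

Let mu0 : mu set0 = 0%E.
Proof. by rewrite /mu outer_open ?inner0//; exact: open0. Qed.

Let mu_ge0 A : (0 <= mu A)%E. Proof. by rewrite lee_fin. Qed.

Let mu_mono : {homo mu : A B / A `<=` B >-> (A <= B)%E}.
Proof. by move=> A B AB; rewrite lee_fin outer_mono. Qed.

Let mu_sigma_subadditive : sigma_subadditive mu.
Proof.
move=> A; apply/lee_addgt0Pr => e e0.
pose d n := e / (2 ^ n.+1)%:R.
have d0 n : 0 < d n by rewrite divr_gt0// ltr0n expn_gt0.
have UP n : {U | [/\ open U, A n `<=` U & inner U < outer (A n) + d n]}.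
  by apply: cid; exact: outer_adherent.
pose U n := sval (UP n).
have oU n : open (U n) by have [] := svalP (UP n).
have AU n : A n `<=` U n by have [] := svalP (UP n).
have Ud n : inner (U n) < outer (A n) + d n by have [] := svalP (UP n).
apply: (@le_trans _ _ (inner (\bigcup_n U n))%:E).
  rewrite lee_fin; apply: outer_inner; first by apply: bigcup_open => n _.
  by apply: subset_bigcup => n _.
apply: (le_trans (inner_bigcup oU)).
apply: le_trans (epsilon_trick xpredT _ (ltW e0)); last by move=> n; exact: mu_ge0.
by apply: lee_nneseries => n _; rewrite ?lee_fin// ltW.
Qed.

#[local] HB.instance Definition _ :=
  isOuterMeasure.Build R X mu mu0 mu_ge0 mu_mono mu_sigma_subadditive.

(** A cut competitor in [V] met with [U] vanishes off a compact [K]. A competitor in [V] minus [K]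
    is nonzero only where the first one is zero, so their sum stays below [1] and competes in
    [V]. *)
Let caratheodory_open U : open U -> mu.-caratheodory U.
Proof.
move=> oU; apply: (@le_caratheodory_measurable R X mu) => A.
rewrite /mu -EFinD lee_fin; apply: le_outer => V oV AV.
apply: (@le_trans _ _ (inner (V `&` U) + outer (V `&` ~` U))).
  apply: lerD; last by apply: outer_mono; exact: setSI.
  by apply: outer_inner; [exact: openI|exact: setSI].
rewrite -lerBrDr; apply: inner_le => f Uf; rewrite lerBrDr.
apply/ler_addgt0Pl => d d0.
have [e [e0 [gc g01 gUV] g0 Jfg]] := J_cut d0 Uf.
set g := f - (f \min cst e) in gc g01 gUV g0 Jfg.
have cK := adm_compact Uf e0; set K := [set x | _] in cK.
have oVK : open (V `&` ~` K).
  by apply: openI => //; apply: closed_openC; exact: compact_closed.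
have VK : V `&` ~` U `<=` V `&` ~` K.
  move=> x [Vx nUx]; split => //= ex; have [_ _ fU] := Uf.
  by move: ex; rewrite /K/= fU ?leNgt ?e0// => -[].
apply: (le_trans (lerD (le_refl _) (outer_inner oVK VK))).
rewrite -lerBrDl; apply: inner_le => h [hc h01 hK].
have : J (g + h) <= inner V.
  apply: J_inner; split; first exact: C0_add.
  - move=> x; rewrite -[_ x]/(g x + h x).
    have /andP[g0x g1x] := g01 x; have /andP[h0x h1x] := h01 x.
    rewrite addr_ge0//=; have [fe|ef] := ltP (f x) e; first by rewrite g0 ?add0r.
    by rewrite hK ?addr0// => -[_]; exact.
  - move=> x nVx; rewrite -[_ x]/(g x + h x) gUV ?hK ?addr0//; by move=> [].
rewrite JD//; move: Jfg; lra.
Qed.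

Context (x0 : X).

Let borel_caratheodory (A : set (borel x0)) : measurable A -> mu.-caratheodory A.
Proof.
apply: smallest_sub; last exact: caratheodory_open.
split => [|B mB|F mF].
- exact: caratheodory_measurable_set0.
- by rewrite setTD; exact: caratheodory_measurable_setC.
- exact: caratheodory_measurable_bigcup.
Qed.

(** The same function retyped: the outer measure instance lives on [X], the measure instance on
    [borel x0]. *)
Let borel_measure : set (borel x0) -> \bar R := mu.

Let borel_measure_ge0 (A : set (borel x0)) : (0 <= borel_measure A)%E.
Proof. exact: mu_ge0. Qed.

Let borel_measure_sigma_additive : semi_sigma_additive borel_measure.
Proof.
move=> F mF tF mUF; apply: (@caratheodory_measure_sigma_additive R (borel x0) mu F) => //.
- by move=> n; exact: borel_caratheodory.
- exact: borel_caratheodory.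
Qed.

#[local] HB.instance Definition _ := isMeasure.Build _ (borel x0) R borel_measure
  mu0 borel_measure_ge0 borel_measure_sigma_additive.

Let borel_measure_fin : fin_num_fun borel_measure.
Proof. by []. Qed.

#[local] HB.instance Definition _ := Measure_isFinite.Build _ (borel x0) R
  borel_measure borel_measure_fin.

Let nu : {finite_measure set (borel x0) -> \bar R} := borel_measure.

Let outer_split A U : mu.-caratheodory U -> outer A = outer (A `&` U) + outer (A `&` ~` U).
Proof. by move=> /(_ A) []. Qed.

Let outer_setU A B : outer (A `|` B) <= outer A + outer B.
Proof.
have := outer_measureU2 (mu : {outer_measure set X -> \bar R}) A B.
by rewrite /= /mu -EFinD lee_fin.
Qed.

(** Every open set around the superlevel set of a near-optimal competitor admits its cut version, so
    this compact set has at least the mass that [J] gives to the cut. Half of [e] pays for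
    near-optimality, half for the cut. *)
Let inner_regular_open U e : 0 < e -> open U ->
  exists K, [/\ compact K, K `<=` U & inner U <= outer K + e].
Proof.
move=> e0 oU; have e2 : 0 < e / 2 by rewrite divr_gt0.
have [_ [f Uf <-] fe] := sup_adherent e2 (has_sup_inner U).
have [d [d0 [gc g01 gU] g0 Jfg]] := J_cut e2 Uf.
exists [set x | d <= f x]; split; first exact: adm_compact Uf d0.
- move=> x /= dx; apply: contrapT => nUx; have [_ _ /(_ _ nUx) fx] := Uf.
  by move: dx; rewrite fx leNgt d0.
- have gK : J (f - (f \min cst d)) <= outer [set x | d <= f x].
    apply: le_outer => V oV KV; apply: J_inner; split => // x nVx.
    by apply: g0; rewrite ltNge; apply/negP => /KV.
  by move: fe Jfg gK; rewrite -/(inner U); lra.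
Qed.

(** Outer regularity of the complement: remove from a compact [K0] carrying almost all the mass an
    open [V] that fits tightly around the complement of [B]. The losses are the mass off [K0] and
    that of [V] inside [B]. *)
Let inner_regular (B : set (borel x0)) e : 0 < e -> measurable B ->
  exists K, [/\ compact K, K `<=` B & outer B <= outer K + e].
Proof.
move=> e0 mB; have e2 : 0 < e / 2 by rewrite divr_gt0.
have [K0 [cK0 _ K0e]] := inner_regular_open e2 openT.
have [V [oV BV Ve]] := outer_adherent (~` B) e2.
exists (K0 `&` ~` V); split.
- by apply: compact_closedI => //; exact: open_closedC.
- by move=> x [_ nVx]; apply: contrapT => /BV.
have mK0 : mu.-caratheodory K0.
  rewrite -(setCK K0); apply: (@caratheodory_measurable_setC R X mu).
  by apply: caratheodory_open; apply: closed_openC; exact: compact_closed.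
have nK0 : outer (~` K0) <= e / 2.
  have := outer_split setT mK0; rewrite !setTI outer_open; last exact: openT.
  by move: K0e; lra.
have VB : outer (V `&` B) <= e / 2.
  have := outer_split V (borel_caratheodory mB).
  rewrite outer_open// => VE.
  have /outer_mono : ~` B `<=` V `&` ~` B by move=> x nBx; split => //; exact: BV.
  by move: Ve VE; lra.
have BK : B `<=` (K0 `&` ~` V) `|` (~` K0 `|` (V `&` B)).
  move=> x Bx; have [K0x|nK0x] := pselect (K0 x); last by right; left.
  by have [Vx|nVx] := pselect (V x); [right; right|left].
have := outer_mono BK; have := outer_setU (K0 `&` ~` V) (~` K0 `|` (V `&` B)).
by have := outer_setU (~` K0) (V `&` B); move: nK0 VB; lra.
Qed.

Let radon_nu : finite_radon nu.
Proof.
move=> B mB; split; apply/eqP; rewrite eq_le; apply/andP; split.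
- apply/lee_addgt0Pr => e e0; have [K [cK KB Be]] := inner_regular e0 mB.
  rewrite (@le_trans _ _ (nu K + e%:E)%E)//.
  by apply: leeD => //; apply: ereal_sup_ubound; exists K.
- by apply: ge_ereal_sup => _ [K [_ KB] <-]; exact: mu_mono.
- by apply: le_ereal_inf_tmp => _ [V [_ BV] <-]; exact: mu_mono.
- apply/lee_addgt0Pr => e e0; have [V [oV BV Ve]] := outer_adherent B e0.
  rewrite (@le_trans _ _ (nu V))//.
    by apply: ereal_inf_lbound; exists V.
  by rewrite /nu/= /borel_measure /mu outer_open// -EFinD lee_fin ltW.
Qed.

(** On open sets [nu] is [inner], which satisfies the upper and lower bounds of the layer comparison
    for [J] as well as for the integral; the comparison therefore runs both ways. *)
Let J_Rintegral f : C0 f -> J f = Rintegral nu setT f.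
Proof.
pose I g := Rintegral nu setT g.
have I_lin a g h : C0 g -> C0 h -> I (a *: g + h) = a * I g + I h.
  exact: Rintegral_C0_lin.
have openE U : open U -> inner U = fine (nu U).
  by move=> oU; rewrite /nu/= /borel_measure /mu/= outer_open.
move: f; apply: (@C0_lin_ext R X J I) => // f fc f01; apply/eqP; rewrite eq_le.
apply/andP; split.
- apply: (@layer_cake_le R X J I inner C) => // [U h oU hc h01 hU|U h oU hc h01 hU].
  + exact: J_inner.
  + rewrite openE//; apply: measure_le_Rintegral => //; first exact: open_borel.
      by move=> x; have /andP[] := h01 x.
    by move=> x /hU ->.
- apply: (@layer_cake_le R X I J inner C) => // [U h oU hc h01 hU|U h oU hc h01 hU].
  + rewrite openE//; apply: Rintegral_le_measure => //; first exact: open_borel.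
    by move=> x; have /andP[] := h01 x.
  + apply: inner_le => g [gc g01 gU]; apply: J_mono => // x.
    have [Ux|nUx] := pselect (U x); first by rewrite hU//; have /andP[] := g01 x.
    by rewrite gU//; have /andP[] := h01 x.
Qed.

Theorem riesz_markov : exists nu : {finite_measure set (borel x0) -> \bar R},
  finite_radon nu /\ forall f, C0 f -> J f = Rintegral nu setT f.
Proof. by exists nu; split; [exact: radon_nu|exact: J_Rintegral]. Qed.

End riesz_markov.

(** * The Hahn-Banach theorem *)

Section hahn_banach.
Context {R : realType} {V : lmodType R}.
(** [p] is sublinear on the subspace [E] only, because it will be built from a supremum, meaningful
    on bounded functions. *)
Variables (E : set V) (p : V -> R) (G0 : set (V * R)).
Hypothesis E_lin : forall a u v, E u -> E v -> E (a *: u + v).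
Hypothesis pD : forall u v, E u -> E v -> p (u + v) <= p u + p v.
Hypothesis pZ : forall a u, 0 <= a -> E u -> p (a *: u) = a * p u.
Hypothesis G0_0 : G0 (0, 0).
Hypothesis G0_lin :
  forall a v r w s, G0 (v, r) -> G0 (w, s) -> G0 (a *: v + w, a * r + s).
Hypothesis G0_p : forall v r, G0 (v, r) -> E v /\ r <= p v.

(* A partial functional is encoded by its graph, a linear relation: domination
   by the sublinear [p] makes such a relation single-valued. *)
Let dominated_graph (G : set (V * R)) : Prop :=
  [/\ G0 `<=` G,
      forall a v r w s, G (v, r) -> G (w, s) -> G (a *: v + w, a * r + s) &
      forall v r, G (v, r) -> E v /\ r <= p v].

Let E0 : E 0. Proof. by have [] := G0_p G0_0. Qed.

Let EZ a u : E u -> E (a *: u).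
Proof. by move=> /(E_lin a) /(_ E0); rewrite addr0. Qed.

Let ED u v : E u -> E v -> E (u + v).
Proof. by move=> /(E_lin 1) /[apply]; rewrite scale1r. Qed.

Let p0 : p 0 = 0.
Proof. by have := pZ (lexx 0) E0; rewrite scale0r mul0r. Qed.

Let graph0 G : dominated_graph G -> G (0, 0).
Proof. by case=> + _ _; apply. Qed.

(** The value [a] at [v0] must lie above every [r - p (v - v0)] and below every [p (w + v0) - s].
    Subadditivity of [p] puts the former below the latter, and [a] is the supremum of the former. *)
Let graph_extension G v0 : dominated_graph G -> E v0 ->
  (forall r, ~ G (v0, r)) ->
  exists a, dominated_graph
    [set x | exists t v r, G (v, r) /\ x = (v + t *: v0, r + t * a)].
Proof.
move=> dG Ev0 nG; have [SG Glin Gp] := dG; have G00 := graph0 dG.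
have GZ a v r : G (v, r) -> G (a *: v, a * r).
  by move=> /(Glin a) /(_ G00); rewrite !addr0.
pose L := [set x | exists v r, G (v, r) /\ x = r - p (v - v0)].
have Lub w s : G (w, s) -> ubound L (p (w + v0) - s).
  move=> Gws _ [v [r [Gvr ->]]].
  have [Ev _] := Gp _ _ Gvr; have [Ew _] := Gp _ _ Gws.
  have := Glin 1 _ _ _ _ Gvr Gws; rewrite scale1r mul1r => /Gp[_ rs].
  have Ev' : E (v - v0) by rewrite addrC -scaleN1r; apply: E_lin.
  have := pD Ev' (ED Ew Ev0); rewrite addrACA addNr addr0.
  by move: rs; lra.
have L0 : L (- p (- v0)) by exists 0, 0; split => //; rewrite !sub0r.
have supL : has_sup L by split; [exists (- p (- v0))|exists (p (0 + v0) - 0); exact: Lub].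
exists (sup L); split.
- move=> [v r] Svr; exists 0, v, r; split; first exact: SG.
  by rewrite scale0r mul0r !addr0.
- move=> a _ _ _ _ [t [v [r [Gvr [-> ->]]]]] [t' [w [s [Gws [-> ->]]]]].
  exists (a * t + t'), (a *: v + w), (a * r + s); split; first exact: Glin.
  by rewrite scalerDr !scalerA addrACA -scalerDl; congr (_, _); ring.
- move=> _ _ [t [v [r [Gvr [-> ->]]]]].
  have [Ev rp] := Gp _ _ Gvr.
  split; first by rewrite addrC; apply: E_lin.
  (* After rescaling by the inverse of the absolute value of [t], a negative [t] uses the lower
     bounds on [a] and a positive one the upper bounds. *)
  have [t0|t0|->] := ltgtP t 0; last by rewrite scale0r mul0r !addr0.
  + have Gw := GZ (- t)^-1 _ _ Gvr.
    have u0 : 0 < - t by rewrite oppr_gt0.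
    have /ubP := sup_upper_bound supL.
    move=> /(_ ((- t)^-1 * r - p ((- t)^-1 *: v - v0))).
    have Ew : E ((- t)^-1 *: v - v0) by rewrite addrC -scaleN1r; apply: E_lin => //; exact: EZ.
    have := pZ (ltW u0) Ew.
    rewrite scalerBr scalerA mulfV ?gt_eqF// scale1r scaleNr opprK => ->.
    have Lw : L ((- t)^-1 * r - p ((- t)^-1 *: v - v0)).
      by exists ((- t)^-1 *: v), ((- t)^-1 * r).
    move=> /(_ Lw); rewrite -(ler_pM2l u0) mulrBr mulrA mulfV ?gt_eqF// mul1r.
    lra.
  + have Gw := GZ t^-1 _ _ Gvr.
    have : sup L <= p (t^-1 *: v + v0) - t^-1 * r.
      by apply: ge_sup; [exact: supL.1|exact: Lub].
    have Ew : E (t^-1 *: v + v0) by apply: E_lin.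
    have := pZ (ltW t0) Ew.
    rewrite scalerDr scalerA mulfV ?gt_eqF// scale1r => ->.
    rewrite -(ler_pM2l t0) mulrBr mulrA mulfV ?gt_eqF// mul1r.
    lra.
Qed.

Theorem hahn_banach : exists F : V -> R,
  [/\ forall a u v, E u -> E v -> F (a *: u + v) = a * F u + F v,
      forall v r, G0 (v, r) -> F v = r & forall u, E u -> F u <= p u].
Proof.
have dG0 : dominated_graph G0 by split.
(* The property is imposed on the union with [G0] so that it also holds for the union of the empty
   chain. *)
have [F FP Ftot|A [dA Amax]] := @Zorn_bigcup _ (fun A => dominated_graph (A `|` G0)).
  have common x y : (\bigcup_(X in F) X `|` G0) x -> (\bigcup_(X in F) X `|` G0) y ->
      exists2 G, dominated_graph G & [/\ G x, G y & G `<=` \bigcup_(X in F) X `|` G0].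
    have sub X : F X -> X `|` G0 `<=` \bigcup_(X in F) X `|` G0.
      by move=> FX; apply: setSU; exact: bigcup_sup.
    move=> [[B FB Bx]|Gx] [[C FC Cy]|Gy].
    - have [BC|CB] := Ftot _ _ FB FC.
      + exists (C `|` G0); first exact: FP.
        by split; [left; exact: BC|left|exact: sub].
      + exists (B `|` G0); first exact: FP.
        by split; [left|left; exact: CB|exact: sub].
    - by exists (B `|` G0); [exact: FP|split; [left|right|exact: sub]].
    - by exists (C `|` G0); [exact: FP|split; [right|left|exact: sub]].
    - by exists G0 => //; split => //; exact: subsetUr.
  split.
  - exact: subsetUr.
  - by move=> a v r w s /common /[apply] -[G [_ Glin _] [Gv Gw]]; apply; exact: Glin.
  - by move=> v r /[dup] /common /[apply] -[G [_ _ Gp] [Gv _ _]]; exact: Gp.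
set G := A `|` G0 in dA; have [SG Glin Gp] := dA.
have Gtot v : E v -> exists r, G (v, r).
  move=> Ev; apply: contrapT => /forallNP nG.
  have [a] := graph_extension dA Ev nG; set B := [set x | _] => dB.
  have GB : G `<=` B.
    by move=> [w s] Gw; exists 0, w, s; rewrite scale0r mul0r !addr0.
  apply: (Amax B).
    split; first by apply: subset_trans GB; exact: subsetUl.
    move=> BA; apply: (nG a); left; apply: BA; exists 1, 0, 0.
    by split; [exact: graph0|rewrite scale1r mul1r !add0r].
  by rewrite setUidl//; apply: subset_trans GB; exact: subsetUr.
have Guniq v r s : G (v, r) -> G (v, s) -> r = s.
  move=> Gr Gs; apply/eqP; rewrite eq_le.
  have := Glin (-1) _ _ _ _ Gr Gs; rewrite scaleN1r addNr => /Gp[_]; rewrite p0.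
  have := Glin (-1) _ _ _ _ Gs Gr; rewrite scaleN1r addNr => /Gp[_]; rewrite p0.
  lra.
pose F v := xget 0 [set r | G (v, r)].
have FG v : E v -> G (v, F v) by move=> /Gtot; exact: xgetPex.
exists F; split.
- move=> a u v Eu Ev; apply: (Guniq (a *: u + v)); first by apply: FG; exact: E_lin.
  by apply: Glin; exact: FG.
- move=> v r Gvr; apply: (Guniq v); last by right.
  by apply: FG; have [] := G0_p Gvr.
- by move=> u /FG /Gp[].
Qed.

End hahn_banach.

(** * Signed Radon measures *)

Section signed_measures.
Context {d : measure_display} {T : measurableType d} {R : realType}.

(** An equality of differences with the negative terms moved across, so that both sides are
    integrals against genuine measures. *)
Lemma Rintegral_measure_add (m1 m2 m3 m4 : {measure set T -> \bar R}) (f : T -> R) :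
  (forall A, measurable A -> m1 A + m2 A = m3 A + m4 A)%E ->
  m1.-integrable setT (EFin \o f) -> m2.-integrable setT (EFin \o f) ->
  m3.-integrable setT (EFin \o f) -> m4.-integrable setT (EFin \o f) ->
  Rintegral m1 setT f + Rintegral m2 setT f =
  Rintegral m3 setT f + Rintegral m4 setT f.
Proof.
move=> m1234 f1 f2 f3 f4; have mf := measurable_int _ f1.
rewrite /Rintegral -!fineD ?integrable_fin_num//; congr fine.
rewrite -!integral_measure_add//; apply: eq_measure_integral => A mA _.
exact: (etrans (measure_addE m1 m2 A) (etrans (m1234 _ mA) (esym (measure_addE m3 m4 A)))).
Qed.

End signed_measures.

Section radon.
Context {R : realType} {X : topologicalType}.
Hypothesis hausdorffX : hausdorff_space X.
Hypothesis lcX : locally_compact [set: X].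
Context (x0 : X).

(** The Jordan parts need not be [nu1] and [nu2], nor are they known to be Radon. Only the two sums
    obtained by crossing the negative parts are compared. *)
Lemma charge_integral_C0 (mu : {charge set (borel x0) -> \bar R})
    (nu1 nu2 : {finite_measure set (borel x0) -> \bar R}) (f : X -> R) :
  (forall A, measurable A -> mu A = nu1 A - nu2 A)%E -> C0 f ->
  charge_integral (T := borel x0) mu f = Rintegral nu1 setT f - Rintegral nu2 setT f.
Proof.
move=> muE fc; rewrite /charge_integral.
set hd := svalP (hahn_sets mu).
have C0i (m : {finite_measure set (borel x0) -> \bar R}) := C0_integrable m fc.
have := @Rintegral_measure_add _ (borel x0) R (jordan_pos hd) nu2 (jordan_neg hd) nu1 f _
  (C0i (jordan_pos hd)) (C0i nu2) (C0i (jordan_neg hd)) (C0i nu1).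
suff h : forall A, measurable A ->
    (jordan_pos hd A + nu2 A = jordan_neg hd A + nu1 A)%E by move=> /(_ h); lra.
move=> A mA; pose p : {finite_measure set (borel x0) -> \bar R} := jordan_pos hd.
pose n : {finite_measure set (borel x0) -> \bar R} := jordan_neg hd.
have : (p A - n A = nu1 A - nu2 A)%E.
  by rewrite -muE// (jordan_decomp hd mA) /cadd/= cscaleN1.
have fin (m : {finite_measure set (borel x0) -> \bar R}) : m A = (fine (m A))%:E.
  by rewrite fineK// fin_num_measure.
suff : (p A - n A = nu1 A - nu2 A -> p A + nu2 A = n A + nu1 A)%E by [].
rewrite (fin p) (fin n) (fin nu1) (fin nu2) -?EFinN -!EFinD => -[] h.
by congr EFin; lra.
Qed.

(** Inner regularity reduces the claim to compact [K], outer regularity of [nu2] to an open [V]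
    around it; the integral of a Urysohn function lies between [nu1 K] and [nu2 V]. *)
Lemma finite_radon_le (nu1 nu2 : {finite_measure set (borel x0) -> \bar R}) :
  finite_radon nu1 -> finite_radon nu2 ->
  (forall f : X -> R, C0 f -> Rintegral nu1 setT f = Rintegral nu2 setT f) ->
  forall A, measurable A -> (nu1 A <= nu2 A)%E.
Proof.
move=> r1 r2 I12 A mA; rewrite (r1 A mA).1 (r2 A mA).1.
apply: ge_ereal_sup => _ [K [cK KA] <-].
apply: (@le_trans _ _ (nu2 K)); last by apply: ereal_sup_ubound; exists K.
have mK : measurable (K : set (borel x0)) by exact: compact_borel.
rewrite (r2 K mK).2; apply: le_ereal_inf_tmp => _ [V [oV KV] <-].
have mV : measurable (V : set (borel x0)) by exact: open_borel.
have [h [hc h01 hK hV]] := @Urysohn_compact R X hausdorffX lcX K V cK oV KV.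
rewrite -[leLHS]fineK ?fin_num_measure// -[leRHS]fineK ?fin_num_measure// lee_fin.
apply: (@le_trans _ _ (Rintegral nu1 setT h)).
  apply: measure_le_Rintegral => // x; first by have /andP[] := h01 x.
  by move=> /hK ->.
rewrite I12//; apply: Rintegral_le_measure => // x.
by have /andP[] := h01 x.
Qed.

Lemma finite_radon_unique (nu1 nu2 : {finite_measure set (borel x0) -> \bar R}) :
  finite_radon nu1 -> finite_radon nu2 ->
  (forall f : X -> R, C0 f -> Rintegral nu1 setT f = Rintegral nu2 setT f) ->
  forall A, measurable A -> nu1 A = nu2 A.
Proof.
move=> r1 r2 I12 A mA; apply/eqP.
by rewrite eq_le !finite_radon_le// => f fc; rewrite I12.
Qed.

End radon.

(** * Riesz representation in an RKHS *)

Section rkhs.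
Context {R : realType} {X : Type}.
Variables (k : X -> X -> R) (H : set (X -> R)) (dot : (X -> R) -> (X -> R) -> R).
Hypothesis rkhsH : is_rkhs k H dot.
Implicit Types f g h u v : X -> R.

Let H0 : H 0 := rkhs0 rkhsH.

Let HB f g : H f -> H g -> H (f - g).
Proof. by move=> Hf Hg; rewrite addrC -scaleN1r; exact: (rkhsP rkhsH). Qed.

Let HD f g : H f -> H g -> H (f + g).
Proof. by move=> Hf Hg; rewrite -[f]scale1r; exact: (rkhsP rkhsH). Qed.

Let HZ a f : H f -> H (a *: f).
Proof. by move=> Hf; rewrite -[_ *: _]addr0; exact: (rkhsP rkhsH). Qed.

Let dotC f g : H f -> H g -> dot f g = dot g f.
Proof. by move=> Hf Hg; exact: (rkhs_dotC rkhsH). Qed.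

Lemma rkhs_dot0 f : H f -> dot 0 f = 0.
Proof.
move=> Hf; have := rkhs_dotP rkhsH (-1) H0 H0 Hf.
by rewrite scaler0 addr0; lra.
Qed.

Let dotZl a f g : H f -> H g -> dot (a *: f) g = a * dot f g.
Proof.
move=> Hf Hg; have := rkhs_dotP rkhsH a Hf H0 Hg.
by rewrite addr0 rkhs_dot0// addr0.
Qed.

Let dot_lin2 a f g : H f -> H g ->
  dot (a *: f + g) (a *: f + g) = a ^+ 2 * dot f f + 2 * a * dot f g + dot g g.
Proof.
move=> Hf Hg; have Hfg := rkhsP rkhsH a Hf Hg.
rewrite (rkhs_dotP rkhsH)// (dotC Hf Hfg) (dotC Hg Hfg) !(rkhs_dotP rkhsH)//.
by rewrite (dotC Hg Hf); ring.
Qed.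

Lemma rkhs_dot_ge0 f : H f -> 0 <= dot f f.
Proof.
move=> Hf; have [->|f0] := pselect (f = 0); first by rewrite rkhs_dot0.
by apply: ltW; exact: (rkhs_dot_gt0 rkhsH).
Qed.

(** The quadratic is evaluated at its minimum [- b / dot f f]. With [e] arbitrary, this serves both
    Cauchy-Schwarz and the approximate first variation below. *)
Let discriminant f (b e : R) : H f -> (f = 0 -> b = 0) -> 0 <= e ->
  (forall t, 0 <= t ^+ 2 * dot f f + 2 * t * b + e) -> b ^+ 2 <= e * dot f f.
Proof.
move=> Hf fb e0 tP; have [f0|f0] := pselect (f = 0).
  by rewrite fb// expr0n/= mulr_ge0// rkhs_dot_ge0.
have G0 := rkhs_dot_gt0 rkhsH Hf f0.
have := tP (- b / dot f f); set G := dot f f in G0 *.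
have -> : (- b / G) ^+ 2 * G + 2 * (- b / G) * b + e = e - b ^+ 2 / G.
  by field; rewrite gt_eqF.
by rewrite subr_ge0 ler_pdivrMr.
Qed.

Lemma rkhs_cauchy_schwarz f g : H f -> H g -> dot f g ^+ 2 <= dot g g * dot f f.
Proof.
move=> Hf Hg; apply: discriminant => //; [by move=> ->; rewrite rkhs_dot0|exact: rkhs_dot_ge0|].
by move=> t; rewrite -dot_lin2//; apply: rkhs_dot_ge0; exact: (rkhsP rkhsH).
Qed.

Lemma rkhs_eval f x : H f -> f x ^+ 2 <= k x x * dot f f.
Proof.
move=> Hf; have Hk := rkhs_kernel rkhsH; rewrite (rkhs_reproducing rkhsH x Hf).
by rewrite (le_trans (rkhs_cauchy_schwarz Hf (Hk x)))// -(rkhs_reproducing rkhsH).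
Qed.

Section riesz_representation.
Variables (L : (X -> R) -> R) (C : R).
Hypothesis L_lin : forall a f g, H f -> H g -> L (a *: f + g) = a * L f + L g.
Hypothesis C0 : 0 <= C.
Hypothesis L_bounded : forall f, H f -> L f ^+ 2 <= C * dot f f.

Let L0 : L 0 = 0.
Proof. by have := L_lin (-1) H0 H0; rewrite scaler0 addr0; lra. Qed.

(** If [h] represents [L], this is the squared norm of [f - h] minus that of [h], so its minimizer
    is the representer. *)
Let energy f := dot f f - 2 * L f.

(** The inequality of arithmetic and geometric means for [C] and [dot f f], written with squares to
    avoid roots. *)
Let energy_ge f : H f -> - C <= energy f.
Proof.
move=> Hf; have q0 := rkhs_dot_ge0 Hf; have := L_bounded Hf; rewrite /energy.
move: (dot f f) (L f) q0 => q l q0 lq; rewrite leNgt; apply/negP => ql.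
have l1 : (q + C) / 2 < l by clear lq; lra.
have qC0 : 0 <= (q + C) / 2 by rewrite divr_ge0 ?addr_ge0.
have : ((q + C) / 2) ^+ 2 < l ^+ 2 by rewrite ltr_pXn2r// nnegrE// (le_trans qC0 (ltW l1)).
have : 0 <= ((q - C) / 2) ^+ 2 by exact: sqr_ge0.
have -> : ((q + C) / 2) ^+ 2 = ((q - C) / 2) ^+ 2 + C * q by field.
lra.
Qed.

Let m := inf [set energy f | f in H].

Let has_inf_energy : has_inf [set energy f | f in H].
Proof.
split; first by exists (energy 0), 0.
by exists (- C) => _ [f Hf <-]; exact: energy_ge.
Qed.

Let m_le f : H f -> m <= energy f.
Proof. by move=> Hf; apply: (ge_inf has_inf_energy.2); exists f. Qed.

(* A minimizing sequence of the energy is Cauchy by the parallelogram law, and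
   the first variation of the energy at its limit vanishes. *)
Lemma rkhs_riesz_representation :
  exists2 h, H h & forall f, H f -> L f = dot f h.
Proof.
have inv0 n : 0 < n.+1%:R^-1 :> R by rewrite invr_gt0 ltr0n.
have /choice[u uP] : forall n : nat, exists f, H f /\ energy f < m + n.+1%:R^-1.
  by move=> n; have [_ [f Hf <-] fm] := inf_adherent (inv0 n) has_inf_energy; exists f.
have Hu n : H (u n) by have [] := uP n.
have um n : energy (u n) < m + n.+1%:R^-1 by have [] := uP n.
have u_cauchy i j : dot (u i - u j) (u i - u j) <= 2 * i.+1%:R^-1 + 2 * j.+1%:R^-1.
  (* At the midpoint [w] the linear terms cancel: the squared distance is [2 * energy (u i) + 2 *
     energy (u j) - 4 * energy w], and [m] bounds [energy w] from below. *)
  pose w := 2^-1 *: (u i + u j); have Hw : H w by apply: HZ; exact: HD.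
  have := m_le Hw; have := um i; have := um j; rewrite /energy.
  rewrite {1}/w (dotZl _ (HD (Hu i) (Hu j)) Hw) (dotC (HD (Hu i) (Hu j)) Hw).
  rewrite (dotZl _ (HD (Hu i) (Hu j)) (HD (Hu i) (Hu j))).
  have -> : L w = 2^-1 * (L (u i) + L (u j)).
    have := L_lin 2^-1 (HD (Hu i) (Hu j)) H0; rewrite addr0 L0 addr0 => ->.
    by have := L_lin 1 (Hu i) (Hu j); rewrite scale1r mul1r => ->.
  have := dot_lin2 1 (Hu i) (Hu j); rewrite scale1r => ->.
  have := dot_lin2 (-1) (Hu j) (Hu i); rewrite scaleN1r addrC => ->.
  rewrite (dotC (Hu j) (Hu i)) sqrrN !expr1n.
  move: (dot (u i) (u i)) (dot (u j) (u j)) (dot (u i) (u j)) (L (u i)) (L (u j)).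
  by move: (i.+1%:R^-1) (j.+1%:R^-1) => d d' a b c l l'; lra.
have [e e0|h Hh uh] := rkhs_complete rkhsH Hu.
  (* Beyond [N] each reciprocal is below [e ^+ 2 / 4], so the bound in [u_cauchy] is below
     [e ^+ 2]. *)
  pose N := Num.bound (4 / e ^+ 2); exists N => i j Ni Nj.
  have e2 : 0 < e ^+ 2 by rewrite exprn_gt0.
  have small l : (N <= l)%N -> l.+1%:R^-1 < e ^+ 2 / 4.
    move=> Nl; rewrite -[ltRHS]invrK ltf_pV2 ?posrE ?invr_gt0 ?divr_gt0 ?ltr0n//.
    rewrite invf_div (lt_le_trans (archi_boundP _))// ?ler_nat ?divr_ge0 ?ltW//.
    by rewrite leqW.
  rewrite -(ltr_pXn2r (n := 2))// ?nnegrE ?sqrtr_ge0// ?(ltW e0)//.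
  rewrite sqr_sqrtr ?rkhs_dot_ge0//; last exact: HB.
  apply: (le_lt_trans (u_cauchy i j)); have := small _ Ni; have := small _ Nj.
  by move: (i.+1%:R^-1) (j.+1%:R^-1) => a b; lra.
exists h => // g Hg.
(* Moving from the approximate minimizer [u n] along [t *: g] lowers the energy by less than the
   defect [n.+1%:R^-1]; the discriminant of this quadratic in [t] gives the estimate. *)
have variation n : (dot g (u n) - L g) ^+ 2 <= n.+1%:R^-1 * dot g g.
  apply: discriminant => //; first by move=> ->; rewrite rkhs_dot0// L0 subrr.
  move=> t; have Ht := rkhsP rkhsH t Hg (Hu n).
  have := m_le Ht; have := um n; rewrite /energy dot_lin2// L_lin//.
  by move: (n.+1%:R^-1) => d; lra.
apply/eqP; rewrite -subr_eq0 -sqrf_eq0 eq_le sqr_ge0 andbT.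
apply/ler_addgt0Pl => e e0; rewrite addr0.
(* The added [1] makes [G] positive, and [c * G = e / 4] bounds each of the two squared errors,
   which enter the final sum with weight [2]. *)
pose G := dot g g + 1; have G0 : 0 < G by rewrite ltr_wpDl ?rkhs_dot_ge0.
pose c := e / (4 * G); have c0 : 0 < c by rewrite divr_gt0 ?mulr_gt0.
have sc0 : 0 < Num.sqrt c by rewrite sqrtr_gt0.
move/cvgrPdist_lt : uh => /(_ _ sc0)[N _ uN].
pose n := (N + Num.bound c^-1)%N.
have un : dot (u n - h) (u n - h) < c.
  have := uN n (leq_addr _ _); rewrite /= sub0r normrN ger0_norm ?sqrtr_ge0//.
  by rewrite ltr_sqrt.
have nc : n.+1%:R^-1 < c.
  rewrite -[ltRHS]invrK ltf_pV2 ?posrE ?invr_gt0 ?ltr0n//.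
  rewrite (lt_le_trans (archi_boundP _))// ?ler_nat ?invr_ge0 ?(ltW c0)//.
  by rewrite leqW// leq_addl.
have Huh := HB (Hu n) Hh.
have d1 : dot g (u n - h) ^+ 2 <= dot (u n - h) (u n - h) * dot g g.
  exact: rkhs_cauchy_schwarz.
have dE : dot g (u n - h) = dot g (u n) - dot g h.
  rewrite dotC// addrC -scaleN1r (rkhs_dotP rkhsH)// (dotC Hh Hg) (dotC (Hu n) Hg); ring.
have g0 := rkhs_dot_ge0 Hg.
have b1 : dot (u n - h) (u n - h) * dot g g <= c * G.
  by apply: ler_pM => //; [exact: rkhs_dot_ge0|exact: ltW|rewrite lerDl].
have b2 : n.+1%:R^-1 * dot g g <= c * G.
  by apply: ler_pM => //; [exact: ltW|rewrite lerDl].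
have cG : c * G = e / 4 by rewrite /c; field; rewrite gt_eqF.
have q1 : (dot g (u n) - dot g h) ^+ 2 <= e / 4.
  by rewrite -cG -dE; exact: le_trans b1.
have q2 : (dot g (u n) - L g) ^+ 2 <= e / 4.
  by rewrite -cG; exact: le_trans (variation n) b2.
have sq2 (x y : R) : (x - y) ^+ 2 <= 2 * x ^+ 2 + 2 * y ^+ 2.
  by rewrite -subr_ge0 (_ : _ - _ = (x + y) ^+ 2) ?sqr_ge0//; ring.
have -> : L g - dot g h = (dot g (u n) - dot g h) - (dot g (u n) - L g) by ring.
rewrite (le_trans (sq2 _ _))// (_ : e = 2 * (e / 4) + 2 * (e / 4)); last by field.
by rewrite lerD// ler_pM2l.
Qed.

End riesz_representation.
End rkhs.

(** * Separation and the equivalence *)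

Lemma sup_norm_ge {R : realType} {X : Type} (f : X -> R) M :
  (forall x, `|f x| <= M) -> forall x, `|f x| <= sup_norm f.
Proof.
move=> fM x; apply: sup_upper_bound; last by exists x.
by split; [exists `|f x|, x|exists M => _ [y _ <-]].
Qed.

Lemma sup_norm_le {R : realType} {X : Type} (f : X -> R) M :
  0 <= M -> (forall x, `|f x| <= M) -> sup_norm f <= M.
Proof.
move=> M0 fM; have [[x]|nX] := pselect (exists x : X, True).
  by move=> _; apply: ge_sup; [exists `|f x|, x|move=> _ [y _ <-]].
(* On an empty [X] the supremum takes its default value [0], which is why [M] has to be
   non-negative. *)
rewrite /sup_norm; have -> : range (fun x => `|f x|) = set0; last by rewrite sup0.
by apply/seteqP; split => // r [x]; exfalso; apply: nX; exists x.
Qed.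

Section separation.
Context {R : realType} {X : topologicalType} (x0 : X).
Variables (H : set (X -> R)) (g : X -> R) (e : R).
Hypothesis H0 : H 0.
Hypothesis H_lin : forall a f h, H f -> H h -> H (a *: f + h).
Hypothesis HC0 : H `<=` @C0 R X.
Hypothesis gC0 : C0 g.
Hypothesis e0 : 0 < e.
Hypothesis gH : forall f, H f -> e <= sup_norm (g - f).

Let E : set (X * bool -> R) := [set w | exists M, forall y, `|w y| <= M].
(** The supremum of the positive part rather than of the absolute value: it is [0] at [- w] for
    non-negative [w], so a linear functional below a multiple of it is positive. *)
Let M (w : X * bool -> R) : R := sup (range (fun y => Num.max (w y) 0)).

Let has_sup_M w : E w -> has_sup (range (fun y => Num.max (w y) 0)).
Proof.
move=> [c wc]; split; first by exists (Num.max (w (x0, true)) 0), (x0, true).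
exists c => _ [y _ <-]; rewrite ge_max (le_trans (ler_norm _) (wc y)).
exact: le_trans (wc y).
Qed.

Let le_M w y : E w -> w y <= M w.
Proof.
move=> Ew; apply: (@le_trans _ _ (Num.max (w y) 0)); first by rewrite le_max lexx.
by apply: (sup_upper_bound (has_sup_M Ew)); exists y.
Qed.

Let M_ge0 w : E w -> 0 <= M w.
Proof.
move=> Ew; apply: (@le_trans _ _ (Num.max (w (x0, true)) 0)).
  by rewrite le_max lexx orbT.
by apply: (sup_upper_bound (has_sup_M Ew)); exists (x0, true).
Qed.

Let M_le w c : 0 <= c -> (forall y, w y <= c) -> M w <= c.
Proof.
move=> c0 wc; apply: ge_sup; first by exists (Num.max (w (x0, true)) 0), (x0, true).
by move=> _ [y _ <-]; rewrite ge_max wc.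
Qed.

Let E_lin a u v : E u -> E v -> E (a *: u + v).
Proof.
move=> [b ub] [c vc]; exists (`|a| * b + c) => y.
rewrite -[(_ + _) y]/(a * u y + v y) (le_trans (ler_normD _ _))// lerD//.
by rewrite normrM ler_wpM2l.
Qed.

Let MD u v : E u -> E v -> M (u + v) <= M u + M v.
Proof.
move=> Eu Ev; apply: M_le; first by rewrite addr_ge0// M_ge0.
by move=> y; rewrite -[(_ + _) y]/(u y + v y) lerD// le_M.
Qed.

Let M_scale_le a u : 0 < a -> E u -> M (a *: u) <= a * M u.
Proof.
move=> a0 Eu; apply: M_le; first by rewrite mulr_ge0 ?M_ge0// ltW.
by move=> y; rewrite -[(_ *: _) y]/(a * u y) ler_pM2l// le_M.
Qed.

Let MZ a u : 0 <= a -> E u -> M (a *: u) = a * M u.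
Proof.
rewrite le_eqVlt => /predU1P[<- Eu|a0 Eu].
  rewrite scale0r mul0r; apply/eqP; rewrite eq_le M_le//=.
  by apply: M_ge0; exists 0 => y; rewrite normr0.
apply/eqP; rewrite eq_le M_scale_le//= -ler_pdivlMl//.
have Eau : E (a *: u).
  by rewrite -[_ *: _]addr0; apply: E_lin => //; exists 0 => y; rewrite normr0.
have ai : 0 < a^-1 by rewrite invr_gt0.
by have := M_scale_le ai Eau; rewrite scalerA mulVf ?gt_eqF// scale1r.
Qed.

Let glue (u v : X -> R) : X * bool -> R := fun y => if y.2 then u y.1 else v y.1.

Let glue_lin a u v u' v' :
  glue (a *: u + u') (a *: v + v') = a *: glue u v + glue u' v'.
Proof. by apply/funext => -[x []]. Qed.

Let E_glue u v : C0 u -> C0 v -> E (glue u v).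
Proof.
move=> /C0_bounded[b b0 ub] /C0_bounded[c c0 vc]; exists (b + c) => -[x []] /=.
- by rewrite (le_trans (ub x))// lerDl.
- by rewrite (le_trans (vc x))// lerDr.
Qed.

(** The functional that is [0] on [H] and [1] at [g], carried to the pairs [(u, - u)], on which [M]
    is the sup norm of [u]. *)
Let G0 : set ((X * bool -> R) * R) := [set z | exists f t, H f /\
  z = (glue (f + t *: g) (- (f + t *: g)), t)].

Let G0_lin a v r w s : G0 (v, r) -> G0 (w, s) -> G0 (a *: v + w, a * r + s).
Proof.
move=> [f [_ [Hf [-> <-]]]] [h [_ [Hh [-> <-]]]].
exists (a *: f + h), (a * r + s); split; first exact: H_lin.
have -> : a *: f + h + (a * r + s) *: g = a *: (f + r *: g) + (h + s *: g).
  by rewrite scalerDr scalerA scalerDl addrACA.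
by rewrite -glue_lin scalerN -opprD.
Qed.

(** For positive [r], the function [f + r *: g] is [r] times the difference of [g] and an element of
    [H], so its sup norm is at least [r * e]; hence the factor [e^-1]. For other [r] the bound is
    non-negative. *)
Let G0_dom v r : G0 (v, r) -> E v /\ r <= e^-1 * M v.
Proof.
move=> [f [_ [Hf [-> <-]]]].
have fc : C0 (f + r *: g) by apply: C0_add; [exact: HC0|exact: C0_scale].
have Ew : E (glue (f + r *: g) (- (f + r *: g))).
  by apply: E_glue => //; rewrite -scaleN1r; exact: C0_scale.
split => //; set w := glue _ _ in Ew *.
have [r0|r0] := leP r 0.
  by rewrite (le_trans r0)// mulr_ge0 ?M_ge0// invr_ge0 ltW.
rewrite ler_pdivlMl//.
have Hf' : H (- r^-1 *: f) by rewrite -[_ *: _]addr0; exact: H_lin.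
have : e <= M w / r.
  apply: (le_trans (gH Hf')); apply: sup_norm_le; first by rewrite divr_ge0 ?M_ge0// ltW.
  move=> x; rewrite ler_pdivlMr// -{2}(gtr0_norm r0) -normrM.
  have -> : (g - - r^-1 *: f) x * r = (f + r *: g) x.
    rewrite -[(g - _) x]/(g x - - r^-1 * f x) -[(_ + _) x]/(f x + r * g x).
    by field; rewrite gt_eqF.
  rewrite ler_norml; apply/andP; split; last exact: (le_M (x, true)).
  by rewrite lerNl; exact: (le_M (x, false) Ew).
by rewrite ler_pdivlMr// mulrC.
Qed.

(* Hahn-Banach on two copies of [X] yields the positive and the negative part of
   the separating functional at once. *)
Lemma separating_positive_functionals :
  exists J1 J2 : (X -> R) -> R,
  [/\ forall J, J = J1 \/ J = J2 ->
        [/\ forall a f h, C0 f -> C0 h -> J (a *: f + h) = a * J f + J h,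
            forall f, C0 f -> (forall x, 0 <= f x) -> 0 <= J f &
            forall f, C0 f -> (forall x, f x <= 1) -> J f <= e^-1],
      forall f, H f -> J1 f = J2 f & J1 g - J2 g = 1].
Proof.
have pD u v : E u -> E v -> e^-1 * M (u + v) <= e^-1 * M u + e^-1 * M v.
  by move=> Eu Ev; rewrite -mulrDr ler_pM2l ?invr_gt0// MD.
have pZ a u : 0 <= a -> E u -> e^-1 * M (a *: u) = a * (e^-1 * M u).
  by move=> a0 Eu; rewrite MZ// mulrCA.
have G00 : G0 (0, 0).
  exists 0, 0; split => //; congr (_, _).
  by apply/funext => -[x []]; rewrite /glue/= scale0r addr0 ?oppr0.
have [F [F_lin FG FM]] := hahn_banach E_lin pD pZ G00 G0_lin G0_dom.
have C00 := @C0_0 R X.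
have F0 : F 0 = 0.
  have E0 : E 0 by exists 0 => y; rewrite normr0.
  by have := F_lin (-1) 0 0 E0 E0; rewrite scaler0 addr0; lra.
have FN w : E w -> F (- w) = - F w.
  move=> Ew; have E0 : E 0 by exists 0 => y; rewrite normr0.
  by have := F_lin (-1) w 0 Ew E0; rewrite addr0 F0 addr0 scaleN1r mulN1r.
have F_ge0 w : E w -> (forall y, 0 <= w y) -> 0 <= F w.
  move=> Ew w0; rewrite -oppr_le0 -FN//.
  have EN : E (- w) by case: Ew => c wc; exists c => y; rewrite normrN.
  rewrite (le_trans (FM _ EN))// mulr_ge0_le0 ?invr_ge0 ?(ltW e0)//.
  by apply: M_le => // y; rewrite oppr_le0.
have F_le w : E w -> (forall y, w y <= 1) -> F w <= e^-1.
  move=> Ew w1; rewrite (le_trans (FM _ Ew))// ler_piMr ?invr_ge0 ?(ltW e0)//.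
  exact: M_le.
(* The restrictions of [F] to the two copies; their difference is [F] on the pairs [(u, - u)], whose
   values [G0] prescribes. *)
pose J1 u := F (glue u 0); pose J2 u := F (glue 0 u).
have J12 u : C0 u -> J1 u - J2 u = F (glue u (- u)).
  move=> uc; rewrite /J1 /J2 addrC -mulN1r -F_lin; [|exact: E_glue..].
  by rewrite -glue_lin scaler0 addr0 add0r scaleN1r.
exists J1, J2; split.
- move=> J [->|->]; split.
  + move=> a f h fc hc; rewrite -F_lin; [|exact: E_glue..].
    by rewrite -glue_lin scaler0 addr0.
  + move=> f fc f0; apply: F_ge0 => [|[x []]]; [exact: E_glue|exact: f0|exact: lexx].
  + move=> f fc f1; apply: F_le => [|[x []]]; [exact: E_glue|exact: f1|exact: ler01].
  + move=> a f h fc hc; rewrite -F_lin; [|exact: E_glue..].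
    by rewrite -glue_lin scaler0 addr0.
  + move=> f fc f0; apply: F_ge0 => [|[x []]]; [exact: E_glue|exact: lexx|exact: f0].
  + move=> f fc f1; apply: F_le => [|[x []]]; [exact: E_glue|exact: ler01|exact: f1].
- move=> f Hf; apply/eqP; rewrite -subr_eq0 J12; last exact: HC0.
  by apply/eqP; apply: FG; exists f, 0; split => //; rewrite scale0r addr0.
- rewrite J12//; apply: FG; exists 0, 1; split => //.
  by rewrite scale1r add0r.
Qed.

End separation.

(** * The two implications *)

Section main.
Variables (R : realType) (X : topologicalType) (k : X -> X -> R).
Variables (H : set (X -> R)) (dot : (X -> R) -> (X -> R) -> R).
Hypothesis hausdorffX : hausdorff_space X.
Hypothesis lcX : locally_compact [set: X].
Hypothesis rkhsH : is_rkhs k H dot.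
Hypothesis C0k : C0_kernel k H.

Let HC0 : H `<=` @C0 R X. Proof. by case: C0k. Qed.

Let C0_difference (x0 : X) (nu1 nu2 : {finite_measure set (borel x0) -> \bar R})
    (f : X -> R) : R := Rintegral nu1 setT f - Rintegral nu2 setT f.

Let C0_difference_lin x0 (nu1 nu2 : {finite_measure set (borel x0) -> \bar R}) (a : R) f h :
  C0 f -> C0 h -> C0_difference nu1 nu2 (a *: f + h) =
    a * C0_difference nu1 nu2 f + C0_difference nu1 nu2 h.
Proof. by move=> fc hc; rewrite /C0_difference !Rintegral_C0_lin//; ring. Qed.

Let C0_difference_le x0 (nu1 nu2 : {finite_measure set (borel x0) -> \bar R}) f (M : R) :
  C0 f -> (forall x, `|f x| <= M) ->
  `|C0_difference nu1 nu2 f| <= M * (fine (nu1 setT) + fine (nu2 setT)).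
Proof.
move=> fc fM; rewrite (le_trans (ler_normB _ _))// mulrDr lerD//;
  exact: normr_Rintegral_C0.
Qed.

Let double_integral x0 (mu : {charge set (borel x0) -> \bar R})
    (nu1 nu2 : {finite_measure set (borel x0) -> \bar R}) :
  (forall A, measurable A -> mu A = nu1 A - nu2 A)%E ->
  (fun x' => charge_integral (T := borel x0) mu (fun x => k x x')) =
  (fun x' => C0_difference nu1 nu2 (k^~ x')).
Proof.
move=> muE; apply/funext => x'; rewrite (charge_integral_C0 muE)//.
exact/HC0/(rkhs_kernel rkhsH).
Qed.

Lemma universal_of_strictly_integrally_pd :
  (forall x0 : X, strictly_integrally_pd (T := borel x0) k (signed_radon x0 R)) ->
  universal_kernel k H.
Proof.
move=> ipd; case: (C0k) => ck _ _; split => // g gc e e0; apply: contrapT => nf.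
have gH f : H f -> e <= sup_norm (g - f).
  by move=> Hf; rewrite leNgt; apply/negP => fe; apply: nf; exists f.
(* An empty [X] offers no base point, hence no measure to test; there the sup norm is [0] and
   density is immediate. *)
have [[x0 _]|nX] := pselect (exists x : X, True); last first.
  have := gH _ (rkhs0 rkhsH); rewrite leNgt => /negP; apply.
  by rewrite (le_lt_trans _ e0)// sup_norm_le// => x; exfalso; apply: nX; exists x.
have [J1 [J2 [JP JH Jg]]] :=
  separating_positive_functionals x0 (rkhs0 rkhsH) (rkhsP rkhsH) HC0 gc e0 gH.
have [l1 p1 b1] := JP J1 (or_introl erefl).
have [l2 p2 b2] := JP J2 (or_intror erefl).
have [nu1 [r1 J1E]] := riesz_markov hausdorffX lcX l1 p1 b1 x0.
have [nu2 [r2 J2E]] := riesz_markov hausdorffX lcX l2 p2 b2 x0.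
pose mu : {charge set (borel x0) -> \bar R} :=
  cadd (charge_of_finite_measure nu1) (copp (charge_of_finite_measure nu2)).
have muE A : measurable A -> (mu A = nu1 A - nu2 A)%E by [].
have mu_neq0 : exists2 A, measurable A & mu A != 0%E.
  apply: contrapT => mu0; suff : J1 g = J2 g by move: Jg; lra.
  rewrite J1E// J2E//; congr fine; apply: eq_measure_integral => A mA _.
  have : mu A = 0%E by apply: contrapT => /eqP muA; apply: mu0; exists A.
  rewrite muE// -(fineK (fin_num_measure nu1 A mA)) -(fineK (fin_num_measure nu2 A mA)).
  rewrite -EFinB => -[] /eqP; rewrite subr_eq0 => /eqP h.
  by rewrite -[LHS]fineK ?fin_num_measure// -[RHS]fineK ?fin_num_measure// h.
have signed_mu : signed_radon x0 R mu by exists nu1, nu2.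
have := ipd x0 mu signed_mu mu_neq0.
rewrite (double_integral muE) (_ : (fun x' => _) = 0).
  rewrite (charge_integral_C0 muE); last exact: C0_0.
  by rewrite /Rintegral !integral0 subrr ltxx.
apply/funext => x'; have Hk := rkhs_kernel rkhsH x'.
by rewrite /C0_difference -J1E ?JH ?J2E ?subrr//; exact: HC0.
Qed.

Lemma strictly_integrally_pd_of_universal (x0 : X) : universal_kernel k H ->
  strictly_integrally_pd (T := borel x0) k (signed_radon x0 R).
Proof.
move=> [_ _ dense] mu [nu1 [nu2 [r1 r2 muE]]] [A mA muA].
pose L := C0_difference nu1 nu2.
have [_ [K kK] _] := C0k.
pose c := fine (nu1 setT) + fine (nu2 setT).
have c0 : 0 <= c by rewrite addr_ge0// fine_ge0.
have K0 : 0 <= K by exact: le_trans (kK x0 x0).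
(* The evaluation bound gives [sqrt (K * dot f f)] as a uniform bound of [f], and [c] is the sum of
   the total masses of [nu1] and [nu2]. *)
have L_bounded f : H f -> L f ^+ 2 <= c ^+ 2 * K * dot f f.
  move=> Hf; have q0 := rkhs_dot_ge0 rkhsH Hf; pose s := Num.sqrt (K * dot f f).
  have fs x : `|f x| <= s.
    rewrite -sqrtr_sqr ler_wsqrtr// (le_trans (rkhs_eval rkhsH x Hf))//.
    by rewrite ler_wpM2r// (le_trans (ler_norm _) (kK x x)).
  have -> : c ^+ 2 * K * dot f f = (s * c) ^+ 2.
    by rewrite exprMn sqr_sqrtr ?mulr_ge0//; ring.
  rewrite -[leLHS]real_normK ?num_real// ler_pXn2r ?nnegrE ?mulr_ge0 ?sqrtr_ge0//.
  exact: C0_difference_le (HC0 Hf) fs.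
have L_lin a f h : H f -> H h -> L (a *: f + h) = a * L f + L h.
  by move=> /HC0 fc /HC0 hc; exact: C0_difference_lin.
have cK0 : 0 <= c ^+ 2 * K by rewrite mulr_ge0// sqr_ge0.
have [h Hh Lh] := rkhs_riesz_representation rkhsH L_lin cK0 L_bounded.
rewrite (double_integral muE) (_ : (fun x' => _) = h); last first.
  apply/funext => x'; have Hk := rkhs_kernel rkhsH x'.
  by rewrite -/L Lh// (rkhs_dotC rkhsH)// -(rkhs_reproducing rkhsH).
rewrite (charge_integral_C0 muE); last exact: HC0.
rewrite -/(C0_difference _ _ _) -/L Lh//; apply: (rkhs_dot_gt0 rkhsH) => //.
move=> h0; move/eqP : muA; apply.
have LH f : H f -> L f = 0.
  move=> Hf; rewrite Lh// h0 (rkhs_dotC rkhsH)//; last exact: rkhs0 rkhsH.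
  exact: (rkhs_dot0 rkhsH).
have LC0 f : C0 f -> L f = 0.
  move=> fc; apply/eqP; rewrite -normr_eq0 eq_le normr_ge0 andbT.
  apply/ler_addgt0Pl => e e0; rewrite addr0.
  (* The error made by [u] is multiplied by [c]; the added [1] avoids a division by zero when both
     masses vanish. *)
  have d0 : 0 < e / (c + 1) by rewrite divr_gt0// ltr_wpDl.
  have [u Hu fu] := dense f fc _ d0.
  have fuC : C0 (f - u) by apply: C0_sub => //; exact: HC0.
  have [M _ fuM] := C0_bounded fuC.
  have -> : L f = L (f - u).
    by rewrite addrC -scaleN1r /L C0_difference_lin//; [rewrite -/L (LH _ Hu) mulr0 add0r|exact: HC0].
  apply: (le_trans (C0_difference_le _ _ fuC (sup_norm_ge fuM))).
  rewrite (le_trans (ler_wpM2r c0 (ltW fu)))//.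
  by rewrite mulrAC ler_pdivrMr ?ltr_wpDl// ler_pM2l// lerDl.
rewrite muE// (finite_radon_unique hausdorffX lcX r1 r2 _ mA) ?subee ?fin_num_measure//.
by move=> f /LC0 /eqP; rewrite subr_eq0 => /eqP.
Qed.

End main.

Theorem theorem3p14 (R : realType) (X : topologicalType) (k : X -> X -> R)
    (H : set (X -> R)) (dot : (X -> R) -> (X -> R) -> R)
    (hausdorffX : hausdorff_space X)
    (lcX : locally_compact [set: X])
    (rkhsH : is_rkhs k H dot)
    (C0k : C0_kernel k H) :
  (forall x0 : X, strictly_integrally_pd (T := borel x0) k (signed_radon x0 R))
  <-> universal_kernel k H.
Proof.
split; first exact: universal_of_strictly_integrally_pd rkhsH C0k.
by move=> univ x0; exact: (strictly_integrally_pd_of_universal hausdorffX lcX rkhsH C0k).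
Qed.
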